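(* For all integers $k\ge1$ and $n\ge1$, \[ \mathrm{M2spt}_k(n)=\sum_{\vec\pi\in S2,\ |\vec\pi|=n}\omega_k(\vec\pi),\qquad \overline{\mathrm{spt}}_k(n)=\sum_{\vec\pi\in \overline{S},\ |\vec\pi|=n}\omega_k(\vec\pi),\qquad \overline{\mathrm{spt2}}_k(n)=\sum_{\vec\pi\in \overline{S2},\ |\vec\pi|=n}\omega_k(\vec\pi). \]
   Context: Notation: $(a;q)_n=\prod_{j=0}^{n-1}(1-aq^j)$, $(a;q)_\infty=\prod_{j\ge0}(1-aq^j)$. Rank/crank counts ($m\in\mathbb Z$, $n\ge 0$) are defined as coefficients of $z^mq^n$: $N2(m,n)$ in $\sum_{n\ge0} \frac{q^{n^2}(-q;q^2)_n}{(zq^2;q^2)_n(z^{-1}q^2;q^2)_n}$; $M2(m,n)$ in $\frac{(-q;q^2)_\infty(q^2;q^2)_\infty}{(zq^2;q^2)_\infty(z^{-1}q^2;q^2)_\infty}$; $\overline N(m,n)$ in $\sum_{n\ge0}\frac{(-1;q)_n q^{n(n+1)/2}}{(zq;q)_n(z^{-1}q;q)_n}$; $\overline M(m,n)$ in $\frac{(-q;q)_\infty(q;q)_\infty}{(zq;q)_\infty(z^{-1}q;q)_\infty}$; $\overline{N2}(m,n)$ in $\sum_{n\ge0}\frac{q^n(-1;q)_{2n}}{(zq^2;q^2)_n(z^{-1}q^2;q^2)_n}$; $\overline{M2}(m,n)$ in $\frac{(-q;q)_\infty(q^2;q^2)_\infty}{(q;q^2)_\infty(zq^2;q^2)_\infty(z^{-1}q^2;q^2)_\infty}$.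 With $b_k(m)=\binom{m+k-1}{2k}$, set $\mathrm{M2spt}_k(n)=\sum_m b_k(m)(M2(m,n)-N2(m,n))$, $\overline{\mathrm{spt}}_k(n)=\sum_m b_k(m)(\overline M(m,n)-\overline N(m,n))$, $\overline{\mathrm{spt2}}_k(n)=\sum_m b_k(m)(\overline{M2}(m,n)-\overline{N2}(m,n))$. Sets of vector partitions: $\overline{S}$ is the set of pairs $(\pi_1,\pi_2)$ with $\pi_1$ a nonempty partition and $\pi_2$ a partition into distinct parts, each part of $\pi_2$ strictly larger than the smallest part of $\pi_1$ (overpartitions with non-overlined smallest part; $\pi_2$ = overlined parts). $S2$ is the set of pairs $(\pi_1,\pi_2)$ with $\pi_1$ a nonempty partition into even parts and $\pi_2$ a partition into distinct odd parts, each part of $\pi_2$ larger than the smallest part of $\pi_1$. $\overline{S2}$ is the set of triples $(\pi_1,\pi_2,\pi_3)$ with $\pi_1$ a nonempty partition into even parts, $\pi_2$ a partition into odd parts, $\pi_3$ a partition into distinct parts, all parts of $\pi_2$ and $\pi_3$ strictly larger than the smallest part of $\pi_1$. $|\vec\pi|$ is the sum of all parts of all components. If the distinct parts of $\pi_1$ are $n_1<n_2<\dots<n_s$, let $f_j$ be the multiplicity of $n_j$ in $\pi_1$ (and $f_j=0$ for $j>s$). The weight is \[ \omega_k(\vec\pi)=\sum_{\substack{m_1+\dots+m_r=k\\ 1\le r\le k,\ m_i\ge1}}\binom{f_1+m_1-1}{2m_1-1}\sum_{2\le j_2<j_3<\dots<j_r}\binom{f_{j_2}+m_2}{2m_2}\cdots\binom{f_{j_r}+m_r}{2m_r},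 \] the outer sum over compositions of $k$. *)

(* Defs.v *)
From HB Require Import structures.
From mathcomp Require Import all_boot all_algebra.
From mathcomp Require Import finmap.
From mathcomp Require Import boolp classical_sets fsbigop.
From mathcomp Require Import monalg.

Set Implicit Arguments.
Unset Strict Implicit.
Unset Printing Implicit Defensive.

Import GRing.Theory.
Local Open Scope ring_scope.

(* Laurent polynomials in z; f@_m is the coefficient of z^m. The ring structure
   of [monalg] on {malg R[K]} requires K to have no nontrivial units, which
   excludes the exponent group int; hence the explicit convolution below. *)
Definition laurent (R : comNzRingType) := {malg R[int]}.

HB.instance Definition _ (R : comNzRingType) :=
  GRing.Zmodule.copy (laurent R) {malg R[int]}.

Section LaurentRing.
Variable R : comNzRingType.
Implicit Types f g h : laurent R.

Definition laurent_one : laurent R := << (0 : int) >>.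

Definition laurent_mul f g : laurent R :=
  \sum_(i <- msupp f) \sum_(j <- msupp g) << f@_i * g@_j *g i + j >>.

Let mulw (d1 d2 : {fset int}) f g :
    (msupp f `<=` d1)%fset -> (msupp g `<=` d2)%fset ->
  laurent_mul f g =
  \sum_(i <- d1) \sum_(j <- d2) << f@_i * g@_j *g i + j >>.
Proof.
move=> le_d1 le_d2; rewrite /laurent_mul (big_fset_incl _ le_d1) /=.
  apply/eq_bigr=> i _; apply/big_fset_incl => // j _ /mcoeff_outdom ->.
  by rewrite mulr0 monalgU0.
by move=> i _ /mcoeff_outdom fi; rewrite big1 // => j _; rewrite fi mul0r monalgU0.
Qed.

Let mulC : commutative laurent_mul.
Proof.
move=> f g; rewrite /laurent_mul exchange_big /=.
by apply/eq_bigr=> i _; apply/eq_bigr=> j _; rewrite mulrC addrC.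
Qed.

Let mulDl : left_distributive laurent_mul +%R.
Proof.
move=> f g h; have s := fsubset_refl (msupp h).
rewrite (mulw (msuppD_le f g) s) (mulw (fsubsetUl _ (msupp g)) s).
rewrite (mulw (fsubsetUr (msupp f) _) s).
rewrite -big_split /=; apply/eq_bigr=> i _.
rewrite -big_split /=; apply/eq_bigr=> j _.
by rewrite mcoeffD mulrDl monalgUD.
Qed.

Let mul0 : left_zero 0 laurent_mul.
Proof. by move=> f; rewrite /laurent_mul msupp0 big_seq_fset0. Qed.

Let mulUU (c d : R) (i j : int) :
  laurent_mul << c *g i >> << d *g j >> = << c * d *g i + j >>.
Proof.
by rewrite (mulw (@msuppU_le _ _ _ _) (@msuppU_le _ _ _ _)) !big_seq_fset1 !mcoeffUU.
Qed.

Let mul_sumr I (r : seq I) (F : I -> laurent R) f :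
  laurent_mul f (\sum_(i <- r) F i) = \sum_(i <- r) laurent_mul f (F i).
Proof.
apply: (big_morph (laurent_mul f)) => [g h|]; last by rewrite mulC mul0.
by rewrite mulC mulDl !(mulC f).
Qed.

Let mul_suml I (r : seq I) (F : I -> laurent R) f :
  laurent_mul (\sum_(i <- r) F i) f = \sum_(i <- r) laurent_mul (F i) f.
Proof. by rewrite mulC mul_sumr; apply/eq_bigr=> i _; rewrite mulC. Qed.

Let mulA : associative laurent_mul.
Proof.
move=> f g h; rewrite [f]monalgE [g]monalgE [h]monalgE.
move: laurent_mul mul_sumr mul_suml mulUU => mul D S U.
rewrite S [in RHS]S [RHS]S; apply/eq_bigr=> i _.
rewrite S !(D _ _ _ << f@_i *g i >>) [RHS]S; apply/eq_bigr=> j _.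
rewrite !D; apply/eq_bigr=> k _.
by rewrite !U mulrA addrA.
Qed.

Let mul1 : left_id laurent_one laurent_mul.
Proof.
move=> f; rewrite [X in laurent_mul _ X]monalgE mul_sumr [RHS]monalgE.
by apply/eq_bigr=> i _; rewrite mulUU mul1r add0r.
Qed.

Let one_neq0 : laurent_one != 0.
Proof. by rewrite monalgU_eq0 oner_eq0. Qed.

HB.instance Definition _ := GRing.Zmodule_isComNzRing.Build (laurent R)
  mulA mulC mul1 mulDl one_neq0.

End LaurentRing.

(* Formal power series in q, as coefficient sequences. *)
Definition fps (R : Type) := nat -> R.

HB.instance Definition _ (R : Type) := gen_eqMixin (fps R).
HB.instance Definition _ (R : Type) := gen_choiceMixin (fps R).

Section PowerSeries.
Variable R : comNzRingType.
Implicit Types f g h : fps R.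

Definition fpsC (c : R) : fps R := fun n => if n == 0%N then c else 0.
Definition fpsX : fps R := fun n => (n == 1%N)%:R.

Definition fps_add f g : fps R := fun n => f n + g n.
Definition fps_opp f : fps R := fun n => - f n.
Definition fps_mul f g : fps R := fun n => \sum_(i < n.+1) f i * g (n - i)%N.

Let addA : associative fps_add.
Proof. by move=> f g h; apply/funext=> n; apply: addrA. Qed.

Let addC : commutative fps_add.
Proof. by move=> f g; apply/funext=> n; apply: addrC. Qed.

Let add0 : left_id (fpsC 0) fps_add.
Proof. by move=> f; apply/funext=> n; rewrite /fps_add /fpsC if_same add0r. Qed.

Let addN : left_inverse (fpsC 0) fps_opp fps_add.
Proof. by move=> f; apply/funext=> n; rewrite /fps_add /fpsC if_same addNr. Qed.

HB.instance Definition _ := GRing.isZmodule.Build (fps R) addA addC add0 addN.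

Let trunc n f : {poly R} := \poly_(i < n.+1) f i.

Let mulE n f g (p r : {poly R}) :
    (forall i, (i <= n)%N -> p`_i = f i) -> (forall i, (i <= n)%N -> r`_i = g i) ->
  forall i, (i <= n)%N -> (p * r)`_i = fps_mul f g i.
Proof.
move=> pf rg i le_in; rewrite coefM; apply: eq_bigr => j _.
by rewrite pf ?rg ?(leq_trans (leq_subr _ _)) // (leq_trans (leq_ord j)).
Qed.

Let truncE n f i : (i <= n)%N -> (trunc n f)`_i = f i.
Proof. by move=> le_in; rewrite coef_poly ltnS le_in. Qed.

Let mulA : associative fps_mul.
Proof.
move=> f g h; apply/funext=> n.
have t := truncE (n := n).
rewrite -(mulE (t f) (mulE (t g) (t h)) (leqnn n)).
by rewrite -(mulE (mulE (t f) (t g)) (t h) (leqnn n)) mulrA.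
Qed.

Let mulC : commutative fps_mul.
Proof.
move=> f g; apply/funext=> n; have t := truncE (n := n).
by rewrite -(mulE (t f) (t g) (leqnn n)) -(mulE (t g) (t f) (leqnn n)) mulrC.
Qed.

Let mul1 : left_id (fpsC 1) fps_mul.
Proof.
move=> f; apply/funext=> n; rewrite /fps_mul big_ord_recl /= mul1r subn0.
by rewrite big1 ?addr0 // => i _; rewrite mul0r.
Qed.

Let mulDl : left_distributive fps_mul fps_add.
Proof.
move=> f g h; apply/funext=> n; rewrite /fps_add /fps_mul -big_split /=.
by apply: eq_bigr => i _; rewrite mulrDl.
Qed.

Let one_neq0 : fpsC 1 != 0.
Proof. by apply/eqP=> /(congr1 (@^~ 0%N)) /eqP; rewrite oner_eq0. Qed.

HB.instance Definition _ := GRing.Zmodule_isComNzRing.Build (fps R)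
  mulA mulC mul1 mulDl one_neq0.

Definition fps_unit : {pred fps R} := [pred f | `[< exists g, g * f = 1 >]].

Definition fps_inv f : fps R :=
  if f \in fps_unit then xget f [set g | g * f = 1] else f.

Let mulVf : {in fps_unit, left_inverse 1 fps_inv *%R}.
Proof.
move=> f uf; rewrite /fps_inv uf; case: xgetP => // noinv.
by case/asboolP: uf => g /noinv.
Qed.

Let unitPl f g : g * f = 1 -> fps_unit f.
Proof. by move=> gf; apply/asboolP; exists g. Qed.

Let inv_out : {in [predC fps_unit], fps_inv =1 id}.
Proof. by move=> f; rewrite inE /fps_inv => /negbTE ->. Qed.

HB.instance Definition _ := GRing.ComNzRing_hasMulInverse.Build (fps R)
  mulVf unitPl inv_out.

(* Coefficientwise limit; a coefficient that does not stabilize is set to 0. *)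
Definition fps_lim (u : nat -> fps R) : fps R :=
  fun n => xget 0 [set c | exists N0, forall N, (N0 <= N)%N -> u N n = c].

Definition fps_series (u : nat -> fps R) : fps R :=
  fps_lim (fun N => \sum_(0 <= n < N) u n).

(* (a; x)_n and (a; x)_oo *)
Definition qpoch (a x : fps R) (n : nat) : fps R :=
  \prod_(0 <= j < n) (1 - a * x ^+ j).

Definition qpochoo (a x : fps R) : fps R := fps_lim (qpoch a x).

Lemma fps_limE (u : nat -> fps R) f :
  (forall n, exists N0, forall N, (N0 <= N)%N -> u N n = f n) -> fps_lim u = f.
Proof.
move=> cvu; apply/funext=> n; have [N0 uN0] := cvu n.
rewrite /fps_lim; case: xgetP => [c _ [N1 uN1]|/(_ (f n))[]]; last by exists N0.
by rewrite -(uN0 _ (leq_maxl N0 N1)) -(uN1 _ (leq_maxr N0 N1)).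
Qed.

Lemma fps_unit1 f : f 0%N = 1 -> f \is a GRing.unit.
Proof.
move=> f0; pose next (s : seq R) : seq R :=
  rcons s (- \sum_(i < size s) s`_i * f (size s - i)%N).
pose s n := iter n next [:: 1]; pose g : fps R := fun n => (s n)`_n.
have size_s n : size (s n) = n.+1 by elim: n => //= n <-; rewrite size_rcons.
have sE n i : (i <= n)%N -> (s n)`_i = g i.
  elim: n => [|n IHn]; first by case: i.
  rewrite leq_eqVlt => /orP[/eqP -> //|]; rewrite ltnS => le_in.
  by rewrite /= nth_rcons size_s ltnS le_in IHn.
apply/unitrPr; exists g; rewrite mulrC; apply/funext=> -[|n].
  by rewrite [LHS]big_ord_recl big_ord0 /= f0 !mulr1 addr0.
rewrite [LHS]big_ord_recr /= subnn f0 mulr1 {2}/g /= nth_rcons size_s ltnn eqxx.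
rewrite [X in X + _](eq_bigr (fun i : 'I_n.+1 => (s n)`_i * f (n.+1 - i)%N)).
  exact: addrN.
by move=> i _; rewrite sE // -ltnS.
Qed.

End PowerSeries.

Local Notation Zzq := (fps (laurent int)).

Definition z : Zzq := fpsC (<< (1 : int) >> : laurent int).
Definition q : Zzq := @fpsX (laurent int).

Definition coef (F : Zzq) (m : int) (n : nat) : int := (F n)@_m.

Definition N2 := coef (fps_series (fun n =>
  q ^+ (n ^ 2) * qpoch (- q) (q ^+ 2) n /
    (qpoch (z * q ^+ 2) (q ^+ 2) n * qpoch (z^-1 * q ^+ 2) (q ^+ 2) n))).

Definition M2 := coef (
  qpochoo (- q) (q ^+ 2) * qpochoo (q ^+ 2) (q ^+ 2) /
    (qpochoo (z * q ^+ 2) (q ^+ 2) * qpochoo (z^-1 * q ^+ 2) (q ^+ 2))).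

Definition Nbar := coef (fps_series (fun n =>
  qpoch (- 1) q n * q ^+ (n * n.+1)./2 /
    (qpoch (z * q) q n * qpoch (z^-1 * q) q n))).

Definition Mbar := coef (
  qpochoo (- q) q * qpochoo q q /
    (qpochoo (z * q) q * qpochoo (z^-1 * q) q)).

Definition N2bar := coef (fps_series (fun n =>
  q ^+ n * qpoch (- 1) q (2 * n) /
    (qpoch (z * q ^+ 2) (q ^+ 2) n * qpoch (z^-1 * q ^+ 2) (q ^+ 2) n))).

Definition M2bar := coef (
  qpochoo (- q) q * qpochoo (q ^+ 2) (q ^+ 2) /
    (qpochoo q (q ^+ 2) *
     qpochoo (z * q ^+ 2) (q ^+ 2) * qpochoo (z^-1 * q ^+ 2) (q ^+ 2))).

Lemma zV : z * fpsC (<< (-1 : int) >> : laurent int) = 1.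
Proof.
apply/funext=> n; rewrite [LHS]big_ord_recl big1 => [|i _]; last by rewrite mul0r.
case: n => [|n]; rewrite addr0; last exact: mulr0.
have mE (f g : laurent int) : f * g = laurent_mul f g by [].
by rewrite mE /laurent_mul /= !msuppU oner_eq0 !big_seq_fset1 !mcoeffUU.
Qed.

(* The polynomial x(x-1)...(x-r+1)/r!, also for x < 0; the division is exact. *)
Definition binz (x : int) (r : nat) : int :=
  ((\prod_(0 <= i < r) (x - i%:Z)) %/ r`!)%Z.

Lemma binz_nat (n r : nat) : binz n r = 'C(n, r).
Proof.
have -> : binz n r = ((n ^_ r)%:Z %/ r`!)%Z.
  congr (_ %/ _)%Z; elim: r => [|r IHr]; first by rewrite big_nil.
  rewrite big_nat_recr //= IHr ffactnSr PoszM; have [le_rn|lt_nr] := leqP r n.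
    by rewrite subzn.
  by rewrite ffact_small // !mul0r.
by rewrite -bin_ffact PoszM mulzK // eqz_nat -lt0n fact_gt0.
Qed.

Lemma binz_neg (n r : nat) : binz (- n.+1%:Z) r = (-1) ^+ r * 'C(n + r, r)%:Z.
Proof.
have -> : binz (- n.+1%:Z) r = ((-1) ^+ r * ((n + r) ^_ r)%:Z %/ r`!)%Z.
  congr (_ %/ _)%Z; elim: r => [|r IHr]; first by rewrite big_nil.
  rewrite big_nat_recr //= IHr addnS ffactSS PoszM exprS -opprD -PoszD addSn.
  by rewrite !mulN1r !mulNr mulrN mulrCA mulrC mulrA.
by rewrite -bin_ffact PoszM mulrA mulzK // eqz_nat -lt0n fact_gt0.
Qed.

Definition bk (k : nat) (m : int) : int := binz (m + k%:Z - 1) (2 * k).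

(* [\sum_(m \in setT) F m] is the sum over the support of F, here finite since
   each coefficient of q^n is a Laurent polynomial in z. *)
Definition M2spt (k n : nat) : int :=
  \sum_(m \in [set: int]) bk k m * (M2 m n - N2 m n).

Definition sptbar (k n : nat) : int :=
  \sum_(m \in [set: int]) bk k m * (Mbar m n - Nbar m n).

Definition spt2bar (k n : nat) : int :=
  \sum_(m \in [set: int]) bk k m * (M2bar m n - N2bar m n).

(* Partitions are nonincreasing sequences of positive integers. *)
Definition is_partition (p : seq nat) : bool :=
  sorted geq p && all (fun x => 0 < x)%N p.

Definition distinct_parts (p : seq nat) : seq nat := sort leq (undup p).

Definition smallest_part (p : seq nat) : nat := head 0%N (distinct_parts p).

(* f_j for j >= 1: the multiplicity of the j-th smallest distinct part. *)
Definition mult (p : seq nat) (j : nat) : nat :=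
  nth 0%N [seq count_mem x p | x <- distinct_parts p] j.-1.

Definition Sbar : set (seq nat * seq nat) := [set pi |
  [/\ is_partition pi.1, pi.1 != [::],
      is_partition pi.2, uniq pi.2 &
      all (fun x => smallest_part pi.1 < x)%N pi.2]].

Definition S2 : set (seq nat * seq nat) := [set pi |
  [/\ [/\ is_partition pi.1, pi.1 != [::] & all (fun x => ~~ odd x) pi.1],
      [/\ is_partition pi.2, uniq pi.2 & all odd pi.2] &
      all (fun x => smallest_part pi.1 < x)%N pi.2]].

Definition S2bar : set (seq nat * seq nat * seq nat) := [set pi |
  let: (pi1, pi2, pi3) := pi in
  [/\ [/\ is_partition pi1, pi1 != [::] & all (fun x => ~~ odd x) pi1],
      is_partition pi2 /\ all odd pi2,
      is_partition pi3 /\ uniq pi3 &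
      all (fun x => smallest_part pi1 < x)%N (pi2 ++ pi3)]].

Definition size2 (pi : seq nat * seq nat) : nat := (sumn pi.1 + sumn pi.2)%N.

Definition size3 (pi : seq nat * seq nat * seq nat) : nat :=
  (sumn pi.1.1 + sumn pi.1.2 + sumn pi.2)%N.

Definition compositions (k : nat) : set (seq nat) :=
  [set m | all (fun x => 0 < x)%N m /\ sumn m = k].

(* The weight depends only on pi_1. A composition is m = [:: m_1; ...; m_r], the
   inner indices are js = [:: j_2; ...; j_r] with 1 < j_2 < ... < j_r; the inner
   sum has finite support because 'C(m_i, 2 m_i) = 0. *)
Definition omega (k : nat) (pi1 : seq nat) : int :=
  \sum_(m \in compositions k)
    'C(mult pi1 1 + nth 0 m 0 - 1, 2 * nth 0 m 0 - 1)%:Z *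
    \sum_(js \in [set js : seq nat | size js = (size m).-1 /\ path ltn 1%N js])
      \prod_(0 <= i < size js)
        'C(mult pi1 (nth 0 js i) + nth 0 m i.+1, 2 * nth 0 m i.+1)%:Z.

(* Main.v *)
(* The functional [\sum_m b_k(m) f_m] picks the coefficient of [t^k] in a Laurent
   polynomial f written in [t = z + z^-1 - 2], and
   [(1 - z y)(1 - z^-1 y) = (1 - y)^2 - t y =: D(y)]. With x = q or q^2, each rank
   function is [\sum_n E_n / (D(x) ... D(x^n))], where
   [E_n = \prod_(j < n) (e0 - e1 x^j + x x^(2j))] for suitable e0 and e1. Two applications
   of the q-Gauss sum, one to these E_n and one to powers of x times
   [D(1) ... D(x^(m-1))], followed by an exchange of summations, give
     [crank - rank = \sum_(s >= 1) t x^s / D(x^s) \prod_(j > s) (1 - x^j) / D(x^j) P_s],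
   where P_s generates the remaining components of the vector partitions with smallest
   part x^s. Since [t y / D(y)] and [(1 - y) / D(y)] generate the two kinds of binomial
   factors of [omega], the s-th term counts the vector partitions whose smallest part
   corresponds to x^s, with weight [\sum_k omega_k t^k]. *)

From HB Require Import structures.
Require Import Defs.
From mathcomp Require Import all_boot all_algebra.
From mathcomp Require Import finmap.
From mathcomp Require Import boolp classical_sets fsbigop.
From mathcomp Require Import monalg ring zify.

Set Implicit Arguments.
Unset Strict Implicit.
Unset Printing Implicit Defensive.

Import GRing.Theory.
Local Open Scope ring_scope.

(** * Power series by order *)

(** The q-Gauss sum is stated in symmetric functions of its parameters: a b = x / e0 and a + b = e1
    / e0, with base x and lower parameter x^(m+1). No roots or quotients by e0 occur, and the limit
    e0 = 0, where a parameter becomes infinite, is included. The three rank functions have (x, e0,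
    e1) = (q^2, 0, -q), (q, 0, -q) and (q^2, q, -q - q^2); the products of D have (x, x, x (2 + t)),
    since x D(y) = x - x (2 + t) y + x y^2. After the exchange the term m = 0 is the crank function
    itself. Each later term contains D(1) = -t, which is where the factor t of the smallest part
    comes from. Infinite products are hardly manipulated: the crank function enters only through its
    congruences modulo q^M to finite products, the q-Gauss sum only through finite quotients, and
    its value at m = 0 cancels. *)

Section Order.
Variable R : comNzRingType.
Implicit Types (f g : fps R) (a b n : nat).

(** [ordge n (f - g)] serves as congruence modulo q^n throughout; equality of series is congruence
    for all [n]. *)
Definition ordge n f := forall i, (i < n)%N -> f i = 0.

Lemma fpsME f g n : (f * g) n = \sum_(i < n.+1) f i * g (n - i)%N.
Proof. by []. Qed.

Lemma fps0E n : (0 : fps R) n = 0.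
Proof. by case: n. Qed.

Lemma fpsDE f g n : (f + g) n = f n + g n.
Proof. by []. Qed.

Lemma fpsNE f n : (- f) n = - f n.
Proof. by []. Qed.

Lemma fps_sumE I (r : seq I) (P : pred I) (F : I -> fps R) n :
  (\sum_(i <- r | P i) F i) n = \sum_(i <- r | P i) F i n.
Proof. exact: (big_morph (fun f : fps R => f n) (fun f g => fpsDE f g n) (fps0E n)). Qed.

Lemma ordge_le a b f : (a <= b)%N -> ordge b f -> ordge a f.
Proof. by move=> ab Hf i ia; apply: Hf; apply: leq_trans ab. Qed.

Lemma ordge_add n f g : ordge n f -> ordge n g -> ordge n (f + g).
Proof. by move=> Hf Hg i lt_in; rewrite fpsDE Hf ?Hg ?addr0. Qed.

Lemma ordgeN n f : ordge n f -> ordge n (- f).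
Proof. by move=> Hf i lt_in; rewrite fpsNE Hf ?oppr0. Qed.

Lemma ordge_sub n f g : ordge n f -> ordge n g -> ordge n (f - g).
Proof. by move=> Hf Hg; apply: ordge_add => //; apply: ordgeN. Qed.

Lemma ordgeM a b f g : ordge a f -> ordge b g -> ordge (a + b) (f * g).
Proof.
move=> Hf Hg i lt_i; rewrite fpsME big1 // => j _.
have [ja|aj] := ltnP j a; first by rewrite Hf ?mul0r.
by rewrite Hg ?mulr0 //; have := ltn_ord j; lia.
Qed.

Lemma ordgeMr n f g : ordge n f -> ordge n (f * g).
Proof. by move=> Hf; rewrite -[n]addn0; apply: ordgeM. Qed.

Lemma ordgeMl n f g : ordge n f -> ordge n (g * f).
Proof. by rewrite mulrC; apply: ordgeMr. Qed.

Lemma ordge_prod n (F : nat -> fps R) :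
  (forall i, ordge 1 (F i)) -> ordge n (\prod_(0 <= i < n) F i).
Proof.
move=> HF; elim: n => [|n IHn]; first by [].
by rewrite big_nat_recr //= -addn1; apply: ordgeM.
Qed.

Lemma ordgeX n f : ordge 1 f -> ordge n (f ^+ n).
Proof. by move=> Hf; elim: n => // n IHn; rewrite exprS; apply: (@ordgeM 1). Qed.

Lemma ordge_all f g : (forall n, ordge n (f - g)) -> f = g.
Proof. by move=> fg; apply/eqP; rewrite -subr_eq0; apply/eqP/funext => i; rewrite fps0E (fg i.+1). Qed.

Lemma ordge_fpsX : ordge 1 (@fpsX R).
Proof. by case. Qed.

Definition const1 f := f 0%N = 1.

Lemma const1_unit f : const1 f -> f \is a GRing.unit.
Proof. exact: fps_unit1. Qed.

Lemma const1M f g : const1 f -> const1 g -> const1 (f * g).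
Proof. by move=> Hf Hg; rewrite /const1 fpsME big_ord1 /= Hf Hg mul1r. Qed.

Lemma const1V f : const1 f -> const1 f^-1.
Proof.
move=> Hf; have := congr1 (@^~ 0%N) (mulrV (const1_unit Hf)).
by rewrite fpsME big_ord1 /= Hf mul1r.
Qed.

Lemma const1_prod I (r : seq I) (F : I -> fps R) :
  (forall i, const1 (F i)) -> const1 (\prod_(i <- r) F i).
Proof. by move=> HF; elim/big_ind: _ => //; apply: const1M. Qed.

Lemma const1_add f g : const1 f -> ordge 1 g -> const1 (f + g).
Proof. by move=> Hf Hg; rewrite /const1 fpsDE Hf Hg ?addr0. Qed.

Lemma const1_sub f g : const1 f -> ordge 1 g -> const1 (f - g).
Proof. by move=> Hf Hg; apply: const1_add => //; apply: ordgeN. Qed.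

Lemma eqordM n f f' g g' :
  ordge n (f - f') -> ordge n (g - g') -> ordge n (f * g - f' * g').
Proof.
move=> Hf Hg; have -> : f * g - f' * g' = (f - f') * g + f' * (g - g') by ring.
by apply: ordge_add; [apply: ordgeMr | apply: ordgeMl].
Qed.

Lemma eqordV n f f' : const1 f -> const1 f' ->
  ordge n (f - f') -> ordge n (f^-1 - f'^-1).
Proof.
move=> /const1_unit uf /const1_unit uf' Hf.
have -> : f^-1 - f'^-1 = - (f - f') * (f^-1 * f'^-1).
  by rewrite opprB mulrBl mulrCA mulrV // mulr1 mulrA mulrV // mul1r.
by apply: ordgeMr; apply: ordgeN.
Qed.

Lemma eqord_trans n f g h : ordge n (f - g) -> ordge n (g - h) -> ordge n (f - h).
Proof. by move=> fg gh; rewrite -(subrKA g); apply: ordge_add. Qed.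

Lemma eqord_sym n f g : ordge n (f - g) -> ordge n (g - f).
Proof. by move=> fg; rewrite -opprB; apply: ordgeN. Qed.

Lemma eqord_refl n f : ordge n (f - f).
Proof. by rewrite subrr => i _; apply: fps0E. Qed.

Lemma eqord_prod n I (r : seq I) (P : pred I) (F G : I -> fps R) :
  (forall i, P i -> ordge n (F i - G i)) ->
  ordge n (\prod_(i <- r | P i) F i - \prod_(i <- r | P i) G i).
Proof.
move=> HF; apply: (big_ind2 (fun f g : fps R => ordge n (f - g))) => //.
- exact: eqord_refl.
- by move=> f f' g g'; apply: eqordM.
Qed.

Lemma eqordP n f g : ordge n (f - g) <-> (forall i, (i < n)%N -> f i = g i).
Proof.
split=> fg i lt_in; first by apply/eqP; rewrite -subr_eq0; apply/eqP/fg.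
by rewrite fpsDE fpsNE fg // subrr.
Qed.

End Order.

(** * Series summed coefficientwise *)

Section Series.
Variable R : comNzRingType.
Implicit Types (c : fps R) (u v : nat -> fps R).

(* The sum of the series u, provided [u n] has order at least n for every n. *)
Definition osum u : fps R := fun i => \sum_(n < i.+1) u n i.

Lemma osum_widen u i N : (forall n, ordge n (u n)) -> (i < N)%N ->
  \sum_(n < N) u n i = osum u i.
Proof.
move=> Hu lt_iN; rewrite /osum -!(big_mkord xpredT (u^~ i)) /=.
rewrite (@big_cat_nat _ _ _ i.+1) //= [X in _ + X]big_nat_cond [X in _ + X]big1 ?addr0 //.
by move=> n /andP[/andP[lt_in _] _]; apply: Hu.
Qed.

Lemma fps_series_osum u : (forall n, ordge n (u n)) -> fps_series u = osum u.
Proof.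
move=> Hu; apply: fps_limE => i; exists i.+1 => N lt_iN.
by rewrite fps_sumE big_mkord osum_widen.
Qed.

Lemma eq_osum u v : u =1 v -> osum u = osum v.
Proof. by move=> uv; congr osum; apply: funext. Qed.

Lemma osumB u v : osum (fun n => u n - v n) = osum u - osum v.
Proof. by apply/funext => i; rewrite /osum sumrB. Qed.

Lemma osumZ c u : (forall n, ordge n (u n)) -> osum (fun n => c * u n) = c * osum u.
Proof.
move=> Hu; apply/funext => i; rewrite fpsME /osum.
under eq_bigr do rewrite fpsME.
rewrite exchange_big; apply: eq_bigr => j _; rewrite -mulr_sumr; congr (_ * _).
by apply: osum_widen; rewrite ?ltnS ?leq_subr.
Qed.

Lemma osum_recl u : (forall n, ordge n (u n)) ->
  osum u = u 0%N + osum (fun n => u n.+1).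
Proof.
move=> Hu; apply/funext => i; rewrite -(@osum_widen _ i i.+2) //.
by rewrite big_ord_recl.
Qed.

Lemma osum_telescope u : (forall n, ordge n (u n)) ->
  osum (fun n => u n.+1 - u n) = - u 0%N.
Proof. by move=> Hu; rewrite osumB [osum u]osum_recl // opprD addrC subrK. Qed.

(** Coefficient [i] of both sides is a sum over the square [n, m < i.+1], so the interchange is one
    of finite sums. *)
Lemma osum_exchange (u : nat -> nat -> fps R) :
  osum (fun n => osum (u n)) = osum (fun m => osum (u^~ m)).
Proof. by apply/funext => i; rewrite /osum exchange_big. Qed.

Lemma ordge_osum a u : (forall n, ordge a (u n)) -> ordge a (osum u).
Proof. by move=> Hu i lt_ia; rewrite /osum big1 // => n _; apply: Hu. Qed.

End Series.

(** * q-Pochhammer products *)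

Section Pochhammer.
Variable R : comNzRingType.
Implicit Types a x y : fps R.

Lemma qpoch0 a x : qpoch a x 0 = 1.
Proof. by rewrite /qpoch big_nil. Qed.

Lemma qpochS a x n : qpoch a x n.+1 = qpoch a x n * (1 - a * x ^+ n).
Proof. by rewrite /qpoch big_nat_recr. Qed.

Lemma qpochD a x m n : qpoch a x (m + n) = qpoch a x m * qpoch (a * x ^+ m) x n.
Proof.
elim: n => [|n IHn]; first by rewrite addn0 qpoch0 mulr1.
by rewrite addnS !qpochS IHn exprD; ring.
Qed.

Lemma const1_qpoch a x n : ordge 1 a -> const1 (qpoch a x n).
Proof.
by move=> Ha; apply: const1_prod => i; apply: const1_sub => //; apply: ordgeMr.
Qed.

(** Each factor of index at least [n] is 1 modulo q^n because [x] has no constant term. *)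
Lemma qpochoo_mod a x n : ordge 1 x -> ordge n (qpochoo a x - qpoch a x n).
Proof.
move=> Hx; have step N i : (i < N)%N -> qpoch a x N i = qpoch a x i.+1 i.
  move=> lt_iN; rewrite -(subnK lt_iN).
  elim: (N - i.+1)%N => // d IHd; rewrite addSn qpochS mulrBr mulr1 -{}IHd.
  rewrite fpsDE fpsNE (_ : (_ * _ : fps R) i = 0) ?subr0 //.
  suff /(_ i (leqnn _)) : ordge i.+1 (qpoch a x (d + i.+1) * (a * x ^+ (d + i.+1))) by [].
  by do 2!apply: ordgeMl; apply: (ordge_le (leq_addl d i.+1)); apply: ordgeX.
have -> : qpochoo a x = fun i => qpoch a x i.+1 i.
  by apply: fps_limE => i; exists i.+1 => N /step.
by apply/eqordP => i lt_in; rewrite (step n).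
Qed.

Lemma const1_qpochoo a x : ordge 1 a -> ordge 1 x -> const1 (qpochoo a x).
Proof.
move=> Ha Hx; have /eqordP/(_ 0%N isT) := @qpochoo_mod a x 1 Hx.
by rewrite /const1 => ->; apply: const1_qpoch.
Qed.

End Pochhammer.

(** * The q-Gauss sum *)

Section QGauss.
Variables (R : comNzRingType) (x e0 e1 : fps R).
Hypotheses (Hx : ordge 1 x) (He0 : ordge 1 e0) (He1 : ordge 1 e1).

Definition gauss_num n : fps R := \prod_(0 <= j < n) (e0 - e1 * x ^+ j + x * (x ^+ j) ^+ 2).

(** The term of a 2phi1 series with base [x] and lower parameter [x ^+ m.+1]; the power of its
    argument e0 x^m is absorbed into [gauss_num] and [x ^+ (m * n)]. *)
Definition gauss_term m n : fps R :=
  gauss_num n * x ^+ (m * n) / (qpoch x x n * qpoch (x ^+ m.+1) x n).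

Definition gauss m := osum (gauss_term m).

(** Divided by [qpoch x x m], this is the quotient of the product sides of the q-Gauss sum for the
    lower parameters x and x^(m+1). *)
Definition gauss_prod m : fps R :=
  \prod_(0 <= i < m) ((1 - e1 * x ^+ i + e0 * x * (x ^+ i) ^+ 2) / (1 - e0 * x ^+ i)).

Lemma gauss_num0 : gauss_num 0 = 1.
Proof. by rewrite /gauss_num big_nil. Qed.

Lemma gauss_numS n :
  gauss_num n.+1 = gauss_num n * (e0 - e1 * x ^+ n + x * (x ^+ n) ^+ 2).
Proof. by rewrite /gauss_num big_nat_recr. Qed.

Lemma gauss_prod0 : gauss_prod 0 = 1.
Proof. by rewrite /gauss_prod big_nil. Qed.

Lemma gauss_prodS m : gauss_prod m.+1 = gauss_prod m *
  ((1 - e1 * x ^+ m + e0 * x * (x ^+ m) ^+ 2) / (1 - e0 * x ^+ m)).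
Proof. by rewrite /gauss_prod big_nat_recr. Qed.

Lemma ordge_gauss_num n : ordge n (gauss_num n).
Proof.
apply: ordge_prod => i; apply: ordge_add; last exact: ordgeMr.
by apply: ordge_sub => //; apply: ordgeMr.
Qed.

Lemma ordge_expS m : ordge 1 (x ^+ m.+1).
Proof. by rewrite exprS; apply: ordgeMr. Qed.

Lemma const1_qpochS m n : const1 (qpoch (x ^+ m.+1) x n).
Proof. by apply: const1_qpoch; apply: ordge_expS. Qed.

Lemma const1_qpoch1 n : const1 (qpoch x x n).
Proof. exact: const1_qpoch. Qed.

Lemma ordge_gauss_term m n : ordge n (gauss_term m n).
Proof. by do 2!apply: ordgeMr; apply: ordge_gauss_num. Qed.

Lemma const1_1sub f : ordge 1 f -> const1 (1 - f : fps R).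
Proof. by move=> Hf; apply: const1_sub. Qed.

Lemma gauss_termS m n : gauss_term m n.+1 * ((1 - x ^+ n.+1) * (1 - x ^+ (m + n).+1)) =
  gauss_term m n * (x ^+ m * (e0 - e1 * x ^+ n + x * (x ^+ n) ^+ 2)).
Proof.
have u1 := const1_unit (const1_1sub (ordge_expS n)).
have u2 := const1_unit (const1_1sub (ordge_expS (m + n))).
have u3 := const1_unit (const1_qpoch1 n).
have u4 := const1_unit (const1_qpochS m n).
rewrite /gauss_term gauss_numS !qpochS -exprS -exprD addSn.
set a := 1 - _ in u1 *; set b := 1 - _ in u2 *.
move: (gauss_num n) (qpoch _ _ n) (qpoch (_ ^+ m.+1) _ n) u3 u4 => E p r up ur.
rewrite !invrM ?unitrM ?u1 ?u2 ?up ?ur // mulnS exprD.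
set A := _ - _ + _.
rewrite -[RHS]mul1r -(mulVr u1) -[RHS]mul1r -(mulVr u2); ring.
Qed.

Lemma gauss_term_shift m n : gauss_term m.+1 n * (1 - x ^+ (m + n).+1) =
  gauss_term m n * (x ^+ n * (1 - x ^+ m.+1)).
Proof.
have u3 := const1_unit (const1_qpoch1 n).
have u4 := const1_unit (const1_qpochS m n).
have u5 := const1_unit (const1_qpochS m.+1 n).
have shift : qpoch (x ^+ m.+2) x n * (1 - x ^+ m.+1) =
             qpoch (x ^+ m.+1) x n * (1 - x ^+ (m + n).+1).
  rewrite -addSn exprD -qpochS -[n.+1]add1n qpochD qpochS qpoch0 expr0 mulr1 mul1r.
  by rewrite expr1 -exprSr mulrC.
rewrite /gauss_term !invrM // mulSn exprD.
apply: (mulIr u4); apply: (mulIr u5).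
set P := qpoch (x ^+ m.+1) _ _ in shift u4 *; set Q := qpoch (x ^+ m.+2) _ _ in shift u5 *.
set a := 1 - _ in shift *; set b := 1 - _ in shift *.
set c := (qpoch x x n)^-1.
transitivity (gauss_num n * x ^+ n * x ^+ (m * n) * c * (P * b) * (Q^-1 * Q)); first by ring.
rewrite -shift mulVr // mulr1 -[LHS]mulr1 -(mulVr u4); ring.
Qed.

(* The telescoping certificate is [- (1 - x ^+ n) * gauss_term m n]. *)
Lemma gaussS m : gauss m * ((1 - x ^+ m.+1) * (1 - e0 * x ^+ m)) =
  (1 - e1 * x ^+ m + e0 * x * (x ^+ m) ^+ 2) * gauss m.+1.
Proof.
pose H n := gauss_term m n * (1 - x ^+ n).
have HH n : ordge n (H n) by apply: ordgeMr; apply: ordge_gauss_term.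
apply/eqP; rewrite -subr_eq0 mulrC -!osumZ; try exact: ordge_gauss_term.
rewrite -osumB (eq_osum (v := fun n => - (1 - x ^+ m.+1) * (H n.+1 - H n))).
  (* The factor [1 - x ^+ n] makes [H 0] vanish, so the telescoped sum is 0. *)
  rewrite osumZ ?osum_telescope /H ?expr0 ?subrr ?mulr0 ?oppr0 ?mulr0 //.
  by move=> n; apply: ordge_sub => //; apply: ordge_le (HH n.+1).
move=> n; have u2 := const1_unit (const1_1sub (ordge_expS (m + n))).
(* Both neighbours of [gauss_term m n] are rational multiples of it; clearing denominators leaves a
   polynomial identity in x^m and x^n. *)
apply: (mulIr u2); have := gauss_termS m n; have := gauss_term_shift m n.
rewrite /H -!addSn !(exprD x m.+1 n); set b := 1 - _ * x ^+ n.
set f := gauss_term m n; set f' := gauss_term m.+1 n; set f1 := gauss_term m n.+1.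
rewrite {}/b !exprS; move: (x ^+ m) (x ^+ n) => y X E1 E2; set b := 1 - x * y * X.
transitivity ((1 - x * y) * (1 - e0 * y) * f * b
              - (1 - e1 * y + e0 * x * y ^+ 2) * (f' * b)); first by ring.
rewrite E1.
transitivity (- (1 - x * y) * (f1 * ((1 - x * X) * b) - f * (1 - X) * b)); last by ring.
rewrite E2 /b; ring.
Qed.

Lemma const1_gauss_prod m : const1 (gauss_prod m).
Proof.
apply: const1_prod => i; apply: const1M; last first.
  by apply: const1V; apply: const1_1sub; apply: ordgeMr.
apply: const1_add; last by do 2!apply: ordgeMr.
by apply: const1_1sub; apply: ordgeMr.
Qed.

Lemma gaussE m : gauss m * gauss_prod m = gauss 0 * qpoch x x m.
Proof.
elim: m => [|m IHm]; first by rewrite gauss_prod0 qpoch0.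
rewrite qpochS mulrA -IHm gauss_prodS.
have ud : 1 - e0 * x ^+ m \is a GRing.unit.
  by apply: const1_unit; apply: const1_1sub; apply: ordgeMr.
apply: (mulIr ud); rewrite -exprS.
transitivity (gauss_prod m * ((1 - e1 * x ^+ m + e0 * x * (x ^+ m) ^+ 2) * gauss m.+1)
              * ((1 - e0 * x ^+ m)^-1 * (1 - e0 * x ^+ m))); first by ring.
by rewrite -gaussS mulVr // mulr1; ring.
Qed.

(** Every term with [n > 0] carries the factor [x ^+ (m * n)], so only the leading 1 survives modulo
    q^m. This replaces the limit of [m] to infinity. *)
Lemma gauss_mod m : ordge m (gauss m - 1).
Proof.
rewrite /gauss osum_recl; last exact: ordge_gauss_term.
rewrite {1}/gauss_term gauss_num0 muln0 !qpoch0 !mulr1 invr1 mulr1.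
rewrite addrC addKr; apply: ordge_osum => n; rewrite /gauss_term mulrAC.
by apply: ordgeMl; rewrite mulnS exprD; apply: ordgeMr; apply: ordgeX.
Qed.

Lemma const1_gauss m : const1 (gauss m).
Proof.
rewrite /gauss osum_recl; last exact: ordge_gauss_term.
rewrite {1}/gauss_term gauss_num0 muln0 !qpoch0 !mulr1 invr1 mulr1.
apply: const1_add => //; apply: ordge_osum => n.
exact: (ordge_le (ltn0Sn n) (@ordge_gauss_term m n.+1)).
Qed.

Lemma gauss0_mod m : ordge m (gauss 0 - gauss_prod m / qpoch x x m).
Proof.
have uq := const1_unit (const1_qpoch1 m).
rewrite -[gauss 0](mulrK uq) -gaussE -mulrBl -[X in _ - X]mul1r -mulrBl.
by do 2!apply: ordgeMr; apply: gauss_mod.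
Qed.

End QGauss.

(** * The difference of crank and rank *)

Section RankCrank.
Variables (R : comNzRingType) (x t e0 e1 : fps R).
Hypotheses (Hx : ordge 1 x) (He0 : ordge 1 e0) (He1 : ordge 1 e1).

(* With [t = z + z^-1 - 2] this is [(1 - z * y) * (1 - z^-1 * y)]. *)
Definition zfactor (y : fps R) : fps R := (1 - y) ^+ 2 - t * y.

Definition zprod n : fps R := \prod_(0 <= j < n) zfactor (x ^+ j.+1).

Lemma zprodS n : zprod n.+1 = zprod n * zfactor (x ^+ n.+1).
Proof. by rewrite /zprod big_nat_recr. Qed.

Let e1z : fps R := x * (2 + t).

Let He1z : ordge 1 e1z. Proof. exact: ordgeMr. Qed.

Lemma const1_zfactor y : ordge 1 y -> const1 (zfactor y).
Proof.
move=> Hy; apply: const1_sub; last exact: ordgeMl.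
by rewrite expr2; apply: const1M; apply: const1_1sub.
Qed.

Lemma const1_zprod n : const1 (zprod n).
Proof. by apply: const1_prod => i; apply/const1_zfactor/ordge_expS. Qed.

Lemma gauss_num_z n :
  gauss_num x x e1z n = x ^+ n * \prod_(0 <= j < n) zfactor (x ^+ j).
Proof.
elim: n => [|n IHn]; first by rewrite gauss_num0 big_nil expr0 mulr1.
rewrite gauss_numS IHn [in RHS]big_nat_recr //=.
rewrite (exprS x n) /e1z [X in _ = _ * (_ * X)]/zfactor; ring.
Qed.

Lemma gauss_prod_z n : gauss_prod x x e1z n * qpoch x x n = zprod n.
Proof.
elim: n => [|n IHn]; first by rewrite gauss_prod0 /zprod big_nil qpoch0 mulr1.
rewrite zprodS -IHn.
rewrite gauss_prodS qpochS.
have u : 1 - x * x ^+ n \is a GRing.unit.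
  by apply: const1_unit; apply: const1_1sub; apply: ordgeMr.
set d := 1 - x * x ^+ n in u *; set N := (X in _ * (X / d)).
transitivity (gauss_prod x x e1z n * qpoch x x n * N * (d^-1 * d)); first by ring.
by rewrite mulVr // /N /zfactor /e1z (exprS x n); ring.
Qed.

(** Read from right to left, this turns the rank denominator [zprod n] into a second q-Gauss series,
    the inner sum of the double series [u]. *)
Lemma gauss_z n : gauss x x e1z n / qpoch x x n ^+ 2 = gauss x x e1z 0 / zprod n.
Proof.
have uq := const1_unit (const1_qpoch1 Hx n).
have uz := const1_unit (const1_zprod n).
apply: (mulIr uz); rewrite divrK // -gauss_prod_z expr2 invrM //.
transitivity (gauss x x e1z n * gauss_prod x x e1z n / qpoch x x n *
  ((qpoch x x n)^-1 * qpoch x x n)); first by ring.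
by rewrite mulVr // mulr1 gaussE // mulrK.
Qed.

Let u n m : fps R := gauss_num x e0 e1 n * gauss_num x x e1z m * x ^+ (n * m) /
  (qpoch x x n * qpoch x x m * qpoch x x (n + m)).

(** The factor (x; x)_(n+m) is symmetric in the two indices and splits as (x; x)_n (x^(n+1); x)_m,
    so either inner sum of the double series [u] is a q-Gauss series. *)
Lemma gauss_inner (f0 f1 : fps R) n : ordge 1 f0 -> ordge 1 f1 ->
  osum (fun m => gauss_num x f0 f1 m * x ^+ (n * m) / (qpoch x x m * qpoch x x (n + m)))
  = gauss x f0 f1 n / qpoch x x n.
Proof.
move=> Hf0 Hf1; rewrite mulrC -osumZ; last exact: ordge_gauss_term.
apply: eq_osum => m; rewrite /gauss_term qpochD -exprS.
have u1 := const1_unit (const1_qpoch1 Hx n).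
have u2 := const1_unit (const1_qpoch1 Hx m).
have u3 := const1_unit (const1_qpochS Hx n m).
by rewrite !invrM ?unitrM ?u1 ?u2 ?u3 //; ring.
Qed.

Let Z m : fps R := \prod_(0 <= j < m) zfactor (x ^+ j).

(** The double series [u] is summed over [m] first for the left side and over [n] first for the
    right side. *)
Lemma rank_gauss :
  gauss x x e1z 0 * osum (fun n => gauss_num x e0 e1 n / zprod n) =
  gauss x e0 e1 0 * osum (fun m => x ^+ m * Z m / (qpoch x x m * gauss_prod x e0 e1 m)).
Proof.
have uq n := const1_unit (const1_qpoch1 Hx n).
have up n := const1_unit (const1_gauss_prod x He0 He1 n).
rewrite -!osumZ ; last 2 first.
- by move=> n; do 2!apply: ordgeMr; apply: ordgeX.
- by move=> n; apply: ordgeMr; apply: ordge_gauss_num.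
transitivity (osum (fun n => osum (u n))); last rewrite osum_exchange.
- apply: eq_osum => n; rewrite mulrCA -gauss_z expr2 invrM //.
  transitivity (gauss_num x e0 e1 n / qpoch x x n * (gauss x x e1z n / qpoch x x n)); first by ring.
  rewrite -gauss_inner // -osumZ => [|m]; last first.
    by do 2!apply: ordgeMr; apply: ordge_gauss_num.
  by apply: eq_osum => m; rewrite /u !invrM ?unitrM ?uq //; ring.
- apply: eq_osum => m.
  have -> : gauss x e0 e1 0 = gauss x e0 e1 m * gauss_prod x e0 e1 m / qpoch x x m.
    by rewrite gaussE // mulrK.
  rewrite invrM //; set P := gauss_prod _ _ _ _.
  transitivity (gauss x e0 e1 m / qpoch x x m * (x ^+ m * Z m / qpoch x x m) * (P / P)); last by ring.
  rewrite divrr ?up // mulr1 -gauss_inner // mulrC -osumZ => [|n]; last first.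
    by do 2!apply: ordgeMr; apply: ordge_gauss_num.
  apply: eq_osum => n; rewrite /u gauss_num_z -/(Z m) [(m + n)%N]addnC [(m * n)%N]mulnC.
  by rewrite !invrM ?unitrM ?uq //; ring.
Qed.

Lemma rank_crank (C : fps R) :
  (forall M, ordge M (C - gauss_prod x e0 e1 M * qpoch x x M / zprod M)) ->
  C - osum (fun n => gauss_num x e0 e1 n / zprod n) =
  osum (fun m => t * C * (x ^+ m.+1 * zprod m / (qpoch x x m.+1 * gauss_prod x e0 e1 m.+1))).
Proof.
move=> HC.
(* By hypothesis [C] is the limit of the quotient of the two finite q-Gauss products, hence the
   quotient of the two series at 0. *)
have FG : gauss x e0 e1 0 = C * gauss x x e1z 0.
  apply: ordge_all => M; apply: eqord_trans (@gauss0_mod _ _ _ _ Hx He0 He1 M) _.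
  have -> : gauss_prod x e0 e1 M / qpoch x x M =
    gauss_prod x e0 e1 M * qpoch x x M / zprod M * (gauss_prod x x e1z M / qpoch x x M).
    have uq := const1_unit (const1_qpoch1 Hx M).
    have up := const1_unit (const1_gauss_prod x Hx He1z M).
    rewrite -gauss_prod_z invrM //; set q := qpoch _ _ _ in uq *; set p := gauss_prod x x _ _ in up *.
    transitivity (gauss_prod x e0 e1 M / q * (q / q) * (p / p)); last by ring.
    by rewrite !divrr // !mulr1.
  apply: eqordM; first exact: eqord_sym.
  by apply: eqord_sym; apply: gauss0_mod.
have uG := const1_unit (const1_gauss Hx Hx He1z 0).
apply: (mulrI uG); rewrite mulrBr rank_gauss FG osum_recl => [|m]; last first.
  by do 2!apply: ordgeMr; apply: ordgeX.
rewrite /Z big_nil qpoch0 gauss_prod0 !mulr1 expr0 divr1.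
move: (gauss x x e1z 0) => G; set S := osum _.
have -> : G * C - C * G * (1 + S) = - (C * G * S) by ring.
rewrite -!mulNr /S -!osumZ; last 2 first.
- by move=> m; apply: ordgeMl; do 2!apply: ordgeMr; apply: (ordge_le (leqnSn m)); apply: ordgeX.
- by move=> m; do 2!apply: ordgeMr; apply: (ordge_le (leqnSn m)); apply: ordgeX.
apply: eq_osum => m; rewrite big_nat_recl //= -/(zprod m) expr0.
rewrite {1}/zfactor; ring.
Qed.

End RankCrank.

(** * Symmetrized moments *)

Section Moments.
Implicit Types f g : laurent int.

Definition moment k f : int := \sum_(m <- msupp f) bk k m * f@_m.

Lemma moment_widen k f (d : {fset int}) : (msupp f `<=` d)%fset ->
  moment k f = \sum_(m <- d) bk k m * f@_m.
Proof.
move=> le_d; rewrite /moment (big_fset_incl _ le_d) //= => i _ /mcoeff_outdom ->.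
by rewrite mulr0.
Qed.

Lemma momentD k f g : moment k (f + g) = moment k f + moment k g.
Proof.
rewrite (moment_widen k (msuppD_le f g)).
rewrite (moment_widen k (fsubsetUl (msupp f) (msupp g))).
rewrite (moment_widen k (fsubsetUr (msupp f) (msupp g))) -big_split /=.
by apply: eq_bigr => i _; rewrite mcoeffD mulrDr.
Qed.

Lemma moment0 k : moment k 0 = 0.
Proof. by rewrite /moment msupp0 big_seq_fset0. Qed.

Lemma moment_is_additive k : nmod_morphism (moment k).
Proof. by split; [apply: moment0 | apply: momentD]. Qed.

HB.instance Definition _ k :=
  GRing.isNmodMorphism.Build (laurent int) int (moment k) (moment_is_additive k).

Lemma momentU k (c m : int) : moment k << c *g m >> = bk k m * c.
Proof. by rewrite (moment_widen k (@msuppU_le _ _ _ _)) big_seq_fset1 mcoeffUU. Qed.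

Lemma laurent_mulUU (c d i j : int) :
  (<< c *g i >> : laurent int) * << d *g j >> = << c * d *g i + j >>.
Proof.
rewrite -[LHS]/(laurent_mul _ _) /laurent_mul.
have [-> | c0] := eqVneq c 0; first by rewrite monalgU0 mul0r monalgU0 msupp0 big_seq_fset0.
have [-> | d0] := eqVneq d 0.
  by rewrite monalgU0 mulr0 monalgU0 msupp0 big1 // => ? _; rewrite big_seq_fset0.
by rewrite !msuppU (negbTE c0) (negbTE d0) !big_seq_fset1 !mcoeffUU.
Qed.

(* [z + z^-1 - 2 = (1 - z) ^+ 2 / z], the variable dual to [bk]. *)
Definition tz : laurent int := (<< (1 : int) >> : laurent int) + (<< (-1 : int) >> : laurent int) - 2.

(** Pascal's rule is needed for negative [x] too, since [bk] is summed over all integers; -1 is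
    treated apart because there [x + 1] changes sign. *)
Lemma binzS (x : int) r : binz (x + 1) r.+1 = binz x r.+1 + binz x r.
Proof.
case: x => n.
  have -> : n%:Z + 1 = n.+1%:Z by rewrite -addn1.
  by rewrite !binz_nat binS PoszD.
case: n => [|n].
  rewrite -[Negz 0]/(- 1%:Z) addNr (binz_nat 0) !binz_neg !add0n !binn !bin0n exprS /=.
  by rewrite -mulrDl mulN1r addNr mul0r.
have -> : Negz n.+1 + 1 = - n.+1%:Z by rewrite NegzE -[n.+2]addn1 PoszD; ring.
rewrite NegzE !binz_neg (addSnnS n r) (addSn n r.+1) binS PoszD exprS; ring.
Qed.

(** Two applications of Pascal's rule. Multiplication by [tz] takes second central differences of
    the coefficients, so this makes [bk] dual to the powers of [tz]. *)
Lemma bkS k (m : int) : bk k.+1 (m + 1) + bk k.+1 (m - 1) - bk k.+1 m *+ 2 = bk k m.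
Proof.
rewrite /bk mulnS.
have -> : m + 1 + k.+1%:Z - 1 = m + k%:Z + 1 by rewrite -[k.+1]addn1 PoszD; ring.
have -> : m + k.+1%:Z - 1 = m + k%:Z by rewrite -[k.+1]addn1 PoszD; ring.
have -> : m - 1 + k.+1%:Z - 1 = m + k%:Z - 1 by rewrite -[k.+1]addn1 PoszD; ring.
rewrite binzS; have := binzS (m + k%:Z - 1) (2 * k).+1; rewrite subrK => ->.
by have := binzS (m + k%:Z - 1) (2 * k); rewrite subrK => ->; ring.
Qed.

Lemma moment_tzM k f : moment k.+1 (tz * f) = moment k f.
Proof.
rewrite [f in LHS]monalgE mulr_sumr raddf_sum; apply: eq_bigr => m _ /=.
rewrite /tz !mulrBl !mulrDl mul1r.
rewrite !laurent_mulUU raddfB !raddfD /= !momentU !mul1r -(bkS k m) [1 + m]addrC [-1 + m]addrC.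
ring.
Qed.

Lemma moment0_tzM f : moment 0 (tz * f) = 0.
Proof.
rewrite [f]monalgE mulr_sumr raddf_sum big1 // => m _ /=.
rewrite /tz !mulrBl !mulrDl mul1r.
rewrite !laurent_mulUU raddfB !raddfD /= !momentU !mul1r /bk /binz !big_nil.
by rewrite fact0 divz1; ring.
Qed.

Lemma moment_tzX k j : moment k (tz ^+ j) = (j == k)%:R.
Proof.
elim: k j => [|k IHk] [|j].
- by rewrite expr0 momentU /bk /binz big_nil.
- by rewrite exprS moment0_tzM.
- rewrite expr0 momentU /bk add0r -[k.+1]addn1 PoszD addrK binz_nat bin_small; last by lia.
  by rewrite mul0r addn1.
- by rewrite exprS moment_tzM IHk.
Qed.

Lemma fsum_moment k f : \sum_(m \in [set: int]) bk k m * f@_m = moment k f.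
Proof. by rewrite (fsbigTE (msupp f)) // => m /mcoeff_outdom ->; rewrite mulr0. Qed.

End Moments.

(** * Partitions with prescribed part sizes *)

Section BoundedPartitions.

(** [J] is meant to be increasing: the copies of its head are appended last, so each list comes out
    nonincreasing, as [is_partition] demands. *)
Fixpoint bparts (F : nat) (J : seq nat) : seq (seq nat) :=
  if J is j :: J' then [seq p ++ nseq f j | p <- bparts F J', f <- iota 0 F]
  else [:: [::]].

Lemma bparts_all F J p : p \in bparts F J -> all (mem J) p.
Proof.
elim: J p => [|j J IHJ] p; first by rewrite inE => /eqP->.
case/allpairsP=> -[p' f] /= [/IHJ p'J _ ->]; rewrite all_cat; apply/andP; split.
  by apply: sub_all p'J => i /=; rewrite inE => ->; rewrite orbT.
by apply/allP => i; rewrite mem_nseq => /andP[_ /eqP->]; rewrite inE /= inE eqxx.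
Qed.

Lemma bparts_count F J p i : p \in bparts F J -> i \notin J -> count_mem i p = 0%N.
Proof.
move=> /bparts_all/allP pJ iJ; apply/count_memPn; apply: contra iJ => /pJ.
by rewrite inE.
Qed.

(** The multiplicities range independently below [F], so the sum factors over the part sizes. *)
Lemma bparts_sum (S : comNzRingType) (w : nat -> nat -> S) (Q : S) F J : uniq J ->
  \sum_(p <- bparts F J) (\prod_(j <- J) w j (count_mem j p)) * Q ^+ sumn p =
  \prod_(j <- J) \sum_(0 <= f < F) w j f * Q ^+ (j * f).
Proof.
elim: J => [|j J IHJ] /=; first by rewrite big_seq1 !big_nil mulr1.
case/andP=> jJ uJ; rewrite big_cons -IHJ // big_allpairs_dep /= mulrC mulr_suml.
apply: eq_big_seq => p pJ; rewrite mulr_sumr /index_iota subn0.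
apply: eq_bigr => f _; rewrite big_cons count_cat (bparts_count pJ jJ) count_nseq /=.
rewrite eqxx mul1n add0n sumn_cat sumn_nseq exprD.
rewrite [X in w j f * X](eq_big_seq (fun i => w i (count_mem i p))) => [|i iJ].
  by ring.
rewrite count_cat count_nseq /=; have [ji|_] := eqVneq j i; last by rewrite addn0.
by rewrite ji iJ in jJ.
Qed.

Lemma geq_pairwise p : sorted geq p = pairwise geq p.
Proof. by apply: sorted_pairwise => a b c /= ba cb; apply: leq_trans cb ba. Qed.

Lemma sorted_geq_nseq f j : sorted geq (nseq f j).
Proof. by elim: f => // -[|f] //= ->; rewrite leqnn. Qed.

Lemma sorted_geq_inj p1 p2 : sorted geq p1 -> sorted geq p2 ->
  (forall i, count_mem i p1 = count_mem i p2) -> p1 = p2.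
Proof.
move=> s1 s2 c12; apply: (sorted_eq _ _ s1 s2).
- by move=> a b c /= ba cb; apply: leq_trans cb ba.
- by move=> a b /= ab; apply/eqP; rewrite eqn_leq andbC.
- by apply/allP => i _ /=; rewrite c12.
Qed.

Lemma mem_bparts F J p : sorted ltn J ->
  (p \in bparts F J) =
  [&& sorted geq p, all (mem J) p & all (fun j => count_mem j p < F)%N J].
Proof.
elim: J p => [|j J IHJ] p; first by case: p => [|i p]; rewrite ?inE //= andbF.
move=> sJ; have sJ' := path_sorted sJ.
have jJ i : i \in J -> (j < i)%N.
  by move=> iJ; move: sJ => /= /(order_path_min ltn_trans)/allP ->.
have jnJ : j \notin J by apply/negP => /jJ; rewrite ltnn.
apply/idP/idP => [pJ|].
  rewrite (bparts_all pJ); case/allpairsP: pJ => -[p' f] /= [p'J]; rewrite mem_iota /= => fF ->.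
  have cj := bparts_count p'J jnJ; have p'J' := bparts_all p'J.
  move: p'J; rewrite IHJ // => /and3P[sp' _ cp'].
  rewrite count_cat cj count_nseq /= eqxx mul1n fF /=; apply/andP; split.
    rewrite geq_pairwise pairwise_cat -geq_pairwise sp' /=; apply/andP; split.
      apply/allrelP => a b /(allP p'J') /= /jJ ja; rewrite mem_nseq => /andP[_ /eqP->].
      exact: ltnW.
    by rewrite -geq_pairwise; apply: sorted_geq_nseq.
  apply/allP => i iJ; rewrite count_cat count_nseq /=.
  by have [ji|_] := eqVneq j i; [rewrite ji iJ in jnJ | rewrite addn0 (allP cp')].
case/and3P=> sp pJ /= /andP[cj cJ].
have trg : transitive geq by move=> a b c /= ba cb; apply: leq_trans cb ba.
apply/allpairsP; exists ([seq i <- p | i != j], count_mem j p) => /=; split.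
- rewrite IHJ //; apply/and3P; split; first exact: sorted_filter.
    apply/allP => i; rewrite mem_filter => /andP[ij /(allP pJ)].
    by rewrite !inE (negbTE ij).
  apply/allP => i iJ; rewrite count_filter (leq_ltn_trans _ (allP cJ i iJ)) //.
  by apply: sub_count => a /= /andP[].
- by rewrite mem_iota.
- apply: sorted_geq_inj => // [|i].
    rewrite geq_pairwise pairwise_cat -geq_pairwise sorted_filter //; apply/and3P; split=> //.
      apply/allrelP => a b; rewrite mem_filter mem_nseq => /andP[aj /(allP pJ)] + /andP[_ /eqP->].
      by rewrite inE /= inE (negbTE aj) => /jJ /ltnW.
    by rewrite -geq_pairwise; apply: sorted_geq_nseq.
  rewrite count_cat count_nseq count_filter /= [j == i]eq_sym.
  have [->|ij] := eqVneq i j.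
    by rewrite mul1n [X in _ = (X + _)%N](@eq_count _ _ pred0) ?count_pred0 // => a /=; case: eqP.
  rewrite addn0; apply: eq_count => a /=; have [->|//] := eqVneq a i.
  by rewrite ij.
Qed.

Lemma uniq_bparts F J : sorted ltn J -> uniq (bparts F J).
Proof.
elim: J => [|j J IHJ] //= sJ; have sJ' := path_sorted sJ.
have jnJ : j \notin J.
  by apply/negP => jJ; move: sJ => /= /(order_path_min ltn_trans)/allP /(_ j jJ); rewrite ltnn.
apply: allpairs_uniq; rewrite ?IHJ ?iota_uniq // => -[p1 f1] [p2 f2].
move=> /allpairsP[[p1' f1'] /= [p1J _ [-> ->]]] /allpairsP[[p2' f2'] /= [p2J _ [-> ->]]] e.
have f12 : f1' = f2'.
  have := congr1 (count_mem j) e; rewrite !count_cat !count_nseq /= eqxx !mul1n.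
  by rewrite (bparts_count p1J jnJ) (bparts_count p2J jnJ).
have sz : size p1' = size p2'.
  by have := congr1 size e; rewrite !size_cat !size_nseq f12 => /addIn.
by move/eqP: e; rewrite f12 eqseq_cat // => /andP[/eqP->].
Qed.

Lemma distinct_parts_bparts F J p : sorted ltn J -> p \in bparts F J ->
  distinct_parts p = [seq j <- J | j \in p].
Proof.
move=> sJ pJ; have /allP all_p := bparts_all pJ.
apply: (sorted_eq leq_trans anti_leq).
- by apply: sort_sorted; apply: leq_total.
- apply: (sub_sorted (e := ltn)) => [a b /ltnW //|].
  by apply: sorted_filter => //; apply: ltn_trans.
rewrite perm_sort; apply: uniq_perm; first exact: undup_uniq.
  by apply: filter_uniq; apply: (sorted_uniq ltn_trans ltnn).
move=> i; rewrite mem_undup mem_filter; apply/idP/andP => [ip|[]//].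
by split=> //; have := all_p i ip.
Qed.

End BoundedPartitions.

(** * The weight as a coefficient *)

Section Weight.

(* The polynomials [\sum_(m >= 1) 'C(f + m - 1, 2m - 1) t^m] and
   [\sum_m 'C(f + m, 2m) t^m] of the weight, through their Pascal recursion. *)
Fixpoint weight_pair (S : nzRingType) (t : S) (f : nat) : S * S :=
  if f is f'.+1 then
    let: (a, b) := weight_pair t f' in (a + t * b, b + (a + t * b))
  else (0, 1).

Definition weightA (S : nzRingType) (t : S) f := (weight_pair t f).1.
Definition weightB (S : nzRingType) (t : S) f := (weight_pair t f).2.

Lemma weightAS (S : nzRingType) (t : S) f : weightA t f.+1 = weightA t f + t * weightB t f.
Proof. by rewrite /weightA /weightB /=; case: (weight_pair t f). Qed.

Lemma weightBS (S : nzRingType) (t : S) f : weightB t f.+1 = weightB t f + weightA t f.+1.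
Proof. by rewrite /weightA /weightB /=; case: (weight_pair t f). Qed.

Lemma rmorph_weight (S S' : nzRingType) (phi : {rmorphism S -> S'}) t f :
  phi (weightA t f) = weightA (phi t) f /\ phi (weightB t f) = weightB (phi t) f.
Proof.
elim: f => [|f [IHA IHB]]; first by rewrite /weightA /weightB /= rmorph0 rmorph1.
by rewrite !weightBS !weightAS !rmorphD !rmorphM IHA IHB.
Qed.

(** The two steps of the recursion are Pascal's rule: C(f+1+m, 2m+1) = C(f+m, 2m+1) + C(f+m, 2m) and
    C(f+1+m, 2m) = C(f+m, 2m) + C(f+m, 2m-1). *)
Lemma coef_weight f m :
  (weightA 'X f : {poly int})`_m.+1 = 'C(f + m, m.+1.*2.-1) /\
  (weightB 'X f : {poly int})`_m.+1 = 'C(f + m.+1, m.+1.*2).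
Proof.
elim: f m => [|f IHf] m.
  rewrite coef0 coefC /= !bin_small //; lia.
have B0 : (weightB 'X f : {poly int})`_0 = 1.
  elim: f {IHf} => [|f IHf]; first by rewrite coefC.
  rewrite weightBS weightAS !coefD coefXM /= IHf addr0.
  suff -> : (weightA 'X f : {poly int})`_0 = 0 by [].
  elim: f {IHf} => [|f IHf]; first by rewrite coef0.
  by rewrite weightAS coefD coefXM /= addr0.
have AE : (weightA 'X f.+1 : {poly int})`_m.+1 = 'C(f.+1 + m, m.+1.*2.-1).
  rewrite weightAS coefD coefXM /= (IHf m).1 doubleS /= addSn binS PoszD; congr (_ + _).
  by case: m => [|m]; rewrite ?B0 ?bin0 // (IHf m).2.
split=> //; rewrite weightBS coefD AE (IHf m).2 doubleS /=.
by rewrite (addSn f m.+1) binS PoszD (addSnnS f m).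
Qed.

Lemma coef0_weightA f : (weightA 'X f : {poly int})`_0 = 0.
Proof.
elim: f => [|f IHf]; first by rewrite coef0.
by rewrite weightAS coefD coefXM IHf /= addr0.
Qed.

Lemma coef0_weightB f : (weightB 'X f : {poly int})`_0 = 1.
Proof.
elim: f => [|f IHf]; first by rewrite coefC.
by rewrite weightBS coefD IHf coef0_weightA addr0.
Qed.

Fixpoint sublists (L : seq nat) (r : nat) : seq (seq nat) :=
  match r, L with
  | 0, _ => [:: [::]]
  | _.+1, [::] => [::]
  | r'.+1, x :: L' => [seq x :: js | js <- sublists L' r'] ++ sublists L' r
  end.

Lemma sublists0 L : sublists L 0 = [:: [::]].
Proof. by case: L. Qed.

Lemma mem_sublists L r js : (js \in sublists L r) = (size js == r) && subseq js L.
Proof.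
elim: L r js => [|x L IHL] [|r] js.
- by case: js.
- by case: js => [|j js] //=; rewrite andbF.
- by case: js.
case: js => [|j js].
  by rewrite mem_cat IHL /= orbF; apply/negbTE/mapP => -[].
rewrite mem_cat IHL /= eqSS; have [->|xj] := eqVneq j x.
  rewrite mem_map ?IHL; last by move=> a b [].
  case: eqP => //= _; apply/orP/idP => [[//|]|->]; last by left.
  exact: subseq_trans (subseq_cons _ _).
case: mapP => [[a _ [e _]]|//]; by rewrite e eqxx in xj.
Qed.

Lemma uniq_sublists L r : uniq L -> uniq (sublists L r).
Proof.
elim: L r => [|x L IHL] [|r] //= /andP[xL uL].
rewrite cat_uniq map_inj_uniq ?IHL //=; last by move=> a b [].
rewrite andbT; apply/hasPn => js; rewrite mem_sublists => /andP[_ sub].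
apply/mapP => -[a _ def_js]; case/negP: xL; apply: (mem_subseq sub).
by rewrite def_js inE eqxx.
Qed.

(** [n] is fuel for the structural recursion; all compositions of [k] are listed as soon as
    [k <= n]. *)
Fixpoint comps (n k : nat) : seq (seq nat) :=
  match k, n with
  | 0, _ => [:: [::]]
  | _.+1, 0 => [::]
  | k'.+1, n'.+1 => [seq i.+1 :: m | i <- iota 0 k, m <- comps n' (k' - i)]
  end.

Lemma comps0 n : comps n 0 = [:: [::]].
Proof. by case: n. Qed.

Lemma compsS n k :
  comps n.+1 k.+1 = [seq i.+1 :: m | i <- iota 0 k.+1, m <- comps n (k - i)].
Proof. by []. Qed.

Lemma mem_comps n k m : (k <= n)%N ->
  (m \in comps n k) = all (fun x => 0 < x)%N m && (sumn m == k).
Proof.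
elim: n k m => [|n IHn] [|k] m // le_kn; last rewrite compsS.
- by case: m => [|[|x] m]; rewrite ?inE //= ?andbF.
- by case: m => [|[|x] m]; rewrite ?inE //= ?andbF.
apply/allpairsPdep/andP => [[i [m' [ik m'c ->]]]|[]].
  rewrite mem_iota in ik; rewrite IHn in m'c; last by lia.
  by case/andP: m'c => am /eqP sm; split => //=; lia.
case: m => [|[|i] m] //= am /eqP sm; exists i, m; split=> //.
  by rewrite -[0%N :: _]/(iota 0 k.+1) mem_iota; lia.
by rewrite IHn ?am /=; lia.
Qed.

Lemma uniq_comps n k : uniq (comps n k).
Proof.
elim: n k => [|n IHn] [|k] //; rewrite compsS.
apply: allpairs_uniq_dep; rewrite ?iota_uniq // => -[i m] [j m'] _ _ /=.
by case=> -> ->.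
Qed.

(** In the application to [omega], [m] is the composition without its first part and [L] holds the
    indices j with nonzero multiplicity. *)
Definition inner (b : nat -> nat -> int) (L m : seq nat) : int :=
  \sum_(js <- sublists L (size m)) \prod_(0 <= i < size js) b (nth 0 js i) (nth 0 m i).

Lemma inner_nil b L : inner b L [::] = 1.
Proof. by rewrite /inner sublists0 big_seq1 big_nil. Qed.

Lemma inner_cons b x L i m :
  inner b (x :: L) (i :: m) = b x i * inner b L m + inner b L (i :: m).
Proof.
rewrite /inner /= big_cat big_map /= mulr_sumr; congr (_ + _).
by apply: eq_bigr => js _; rewrite big_nat_recl.
Qed.

(** In the expanded product, the factors contributing a positive power of 'X form a subsequence of
    [L] and their exponents a composition of [k]. The induction splits on whether the first factor
    contributes its constant term 1. *)
Lemma coef_prod_comps (b : nat -> nat -> int) (P : nat -> {poly int}) L n k :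
  (forall j, (P j)`_0 = 1) -> (forall j i, (P j)`_i.+1 = b j i.+1) -> (k <= n)%N ->
  (\prod_(j <- L) P j)`_k = \sum_(m <- comps n k) inner b L m.
Proof.
move=> P0 PS; elim: L n k => [|x L IHL] n k le_kn.
  rewrite big_nil coefC; case: k le_kn => [|k] le_kn.
    by rewrite comps0 big_seq1 inner_nil.
  rewrite big_seq big1 // => m; rewrite mem_comps //.
  by case: m => [|i m] // _; rewrite /inner big_nil.
rewrite big_cons; case: k le_kn => [|k] le_kn.
  by rewrite comps0 big_seq1 inner_nil coefM big_ord1 P0 mul1r (IHL 0%N) // big_seq1 inner_nil.
case: n le_kn => // n le_kn; rewrite coefM big_ord_recl P0 mul1r subn0 (IHL n.+1) //.
rewrite !compsS !big_allpairs_dep /= addrC.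
under [RHS]eq_bigr do under eq_bigr do rewrite inner_cons.
under [RHS]eq_bigr do rewrite big_split /=.
rewrite [RHS]big_split /=; congr (_ + _).
rewrite -(big_mkord xpredT (fun i => (P x)`_i.+1 * (\prod_(j <- L) P j)`_(k.+1 - i.+1))).
rewrite /index_iota subn0; apply: eq_big_seq => i; rewrite mem_iota => ik.
by rewrite (IHL n) ?mulr_sumr ?PS //; lia.
Qed.

Lemma omegaE k p : (0 < k)%N -> p != [::] ->
  omega k p = (weightA 'X (mult p 1) *
    \prod_(j <- behead (distinct_parts p)) weightB 'X (count_mem j p) : {poly int})`_k.
Proof.
case: k => // k _ p0; set s := size (distinct_parts p).
pose L := iota 2 s.-1.
pose b j m : int := 'C(mult p j + m, 2 * m)%:Z.
have -> : \prod_(j <- behead (distinct_parts p)) (weightB 'X (count_mem j p) : {poly int}) =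
          \prod_(j <- L) weightB 'X (mult p j).
  (* Entry [i] of the tail is the part n_(i+2), since [mult] counts from 1. *)
  rewrite (big_nth 0%N) size_behead /L (iotaDl 2 0) big_map /index_iota subn0.
  apply: eq_big_seq => i; rewrite mem_iota /= add0n => ip.
  rewrite /mult nth_behead (nth_map 0%N) //= -/s; lia.
have PS j i : (weightB 'X (mult p j) : {poly int})`_i.+1 = b j i.+1.
  by rewrite (coef_weight _ _).2 /b mul2n.
have outer m : m \in comps k.+1 k.+1 -> 
    \sum_(js \in [set js : seq nat | size js = (size m).-1 /\ path ltn 1%N js])
      \prod_(0 <= i < size js)
        'C(mult p (nth 0 js i) + nth 0 m i.+1, 2 * nth 0 m i.+1)%:Z = inner b L (behead m).
  rewrite mem_comps // => /andP[am _].
  have sL : path ltn 1 L by apply: iota_ltn_sorted 1 s.-1.+1.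
  have in_sub js : js \in sublists L (size m).-1 -> size js = (size m).-1 /\ path ltn 1%N js.
    rewrite mem_sublists => /andP[/eqP -> sub]; split=> //.
    by apply: (@subseq_sorted _ ltn ltn_trans (1%N :: js) (1%N :: L)); rewrite //= eqxx.
  rewrite (fsbigE (sublists L (size m).-1)); first 1 last.
  - by apply: uniq_sublists; apply: iota_uniq.
  - by move=> js; apply: in_sub.
  - move=> js [szj pj]; rewrite mem_sublists szj eqxx /= => nsub; apply/eqP.
    have /allPn[j jjs jL] : ~~ all (mem L) js.
      apply: contra nsub => /allP jsL; suff -> : js = [seq j <- L | j \in js].
        exact: filter_subseq.
      apply: (irr_sorted_eq ltn_trans ltnn); first exact: path_sorted pj.
        by apply: sorted_filter ltn_trans _ _ _; apply: path_sorted sL.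
      by move=> j; rewrite mem_filter; case: (boolP (j \in js)) => //= /jsL.
    (* Such a [j] exceeds the number [s] of distinct parts, so its multiplicity defaults to 0 and
       its factor is C(m_i, 2 m_i) = 0. *)
    have sj : (s < j)%N.
      have /allP/(_ j jjs) := order_path_min ltn_trans pj.
      by move: jL; rewrite inE /= mem_iota; lia.
    rewrite prodf_seq_eq0; apply/hasP; exists (index j js).
      by rewrite mem_index_iota /= -szj index_mem.
    rewrite andTb nth_index // {1}/mult nth_default ?size_map -/s; last by lia.
    have : (0 < nth (0%R : nat) m (index j js).+1)%N.
      by apply: (all_nthP 0%N am); move: jjs; rewrite -index_mem szj; case: (size m).
    by move=> mi0; rewrite bin_small //; lia.
  rewrite /inner size_behead big_mkcond /=; apply: eq_big_seq => js jsL.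
  rewrite mem_set; last exact: in_sub.
  by apply: eq_bigr => i _; rewrite /b nth_behead.
rewrite /omega (fsbigE (comps k.+1 k.+1)); first 1 last.
- exact: uniq_comps.
- move=> m mc; have : m \in comps k.+1 k.+1 := mc.
  by rewrite mem_comps // => /andP[? /eqP].
- by move=> m [am sm]; rewrite mem_comps // am sm eqxx.
rewrite big_mkcond big_seq.
rewrite (eq_bigr (fun m => 'C(mult p 1 + nth 0 m 0 - 1, 2 * nth 0 m 0 - 1)%:Z *
    inner b L (behead m))); last first.
  move=> m mc; rewrite outer // mem_set //.
  by move: mc; rewrite mem_comps // => /andP[? /eqP].
(* [weightA] has no constant term, in accordance with m_1 >= 1. *)
rewrite -big_seq compsS big_allpairs_dep coefM big_ord_recl.
rewrite coef0_weightA mul0r add0r.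
rewrite -(big_mkord xpredT (fun i => (weightA 'X (mult p 1))`_i.+1 *
            (\prod_(j <- L) weightB 'X (mult p j))`_(k.+1 - i.+1))).
rewrite /index_iota subn0; apply: eq_big_seq => i; rewrite mem_iota => ik.
rewrite (@coef_prod_comps b _ L k); [|by move=> j; apply: coef0_weightB|by []|by lia].
rewrite mulr_sumr /=.
apply: eq_bigr => m _; rewrite (coef_weight _ _).1 /=.
by congr (_%:Z * _); congr 'C(_, _); lia.
Qed.

End Weight.

(** * Enumeration of vector partitions by smallest part *)

Lemma smallest_part_min p : p != [::] ->
  smallest_part p \in p /\ (forall i, i \in p -> smallest_part p <= i)%N.
Proof.
move=> p0; have mem_d i : (i \in distinct_parts p) = (i \in p) by rewrite mem_sort mem_undup.
have s_d : sorted leq (distinct_parts p) by apply: sort_sorted; apply: leq_total.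
rewrite /smallest_part; case: (distinct_parts p) mem_d s_d => [|s L] mem_d s_d /=.
  by case: p p0 mem_d => // i p _ /(_ i); rewrite inE eqxx.
split=> [|i]; first by rewrite -mem_d inE eqxx.
rewrite -mem_d inE => /predU1P[->//|iL].
by apply: (allP (order_path_min leq_trans s_d)).
Qed.

Lemma leq_sumn_mem p i : i \in p -> (i <= sumn p)%N.
Proof. by elim: p => //= j p IHp; rewrite inE => /predU1P[->|/IHp]; lia. Qed.

Lemma leq_count_sumn p : all (fun i => 0 < i)%N p -> forall i, (count_mem i p <= sumn p)%N.
Proof. by elim: p => //= j p IHp /andP[j0 /IHp {}IHp] i; have := IHp i; case: eqP => /=; lia. Qed.

Section PartitionSum.
Variables (d N : nat) (T : choiceType) (sz : T -> nat).
Variables (Os : nat -> seq T) (ok : nat -> pred T).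
Hypothesis d_gt0 : (0 < d)%N.
Hypothesis uniq_Os : forall m, uniq (Os m).
Hypothesis OsE : forall m o, (sz o <= N)%N -> (o \in Os m) = ok (d * m.+1) o.

(** The upper end d (N + 1) matches the products [zprod x t N.+1] and [gauss_prod x e0 e1 N.+1] used
    modulo q^(N+1). *)
Definition sizes m : seq nat := [seq d * j | j <- iota m.+1 (N.+1 - m)]%N.

Definition larger_sizes m : seq nat := [seq d * j.+1 | j <- index_iota m.+1 N.+1]%N.

Lemma sizes_cons m : (m <= N)%N -> sizes m = (d * m.+1)%N :: larger_sizes m.
Proof.
move=> le_mN; rewrite /sizes subSn //= /larger_sizes /index_iota subSS.
by congr (_ :: _); rewrite (iotaDl 1 m.+1) -map_comp.
Qed.

Lemma sorted_sizes m : sorted ltn (sizes m).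
Proof.
rewrite sorted_map; apply: sub_sorted (iota_ltn_sorted _ _) => i j /= ltij.
by rewrite ltn_mul2l d_gt0.
Qed.

Lemma mem_sizes m i : (m <= N)%N ->
  (i \in sizes m) = [&& d %| i, d * m.+1 <= i & i <= d * N.+1]%N.
Proof.
move=> le_mN; apply/mapP/and3P => [[j]|[/dvdnP[j ->]]].
  by rewrite mem_iota => jm ->; rewrite dvdn_mulr ?leq_mul2l // ?(gtn_eqF d_gt0) /=; split; lia.
rewrite [(j * d)%N]mulnC !leq_mul2l (gtn_eqF d_gt0) /= => mj jN.
by exists j => //; rewrite mem_iota; lia.
Qed.

Lemma smallest_partE m p : (m <= N)%N -> p \in bparts N.+1 (sizes m) ->
  (d * m.+1)%N \in p -> smallest_part p = (d * m.+1)%N.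
Proof.
move=> le_mN pb sp; rewrite /smallest_part (distinct_parts_bparts (sorted_sizes m) pb).
by rewrite sizes_cons //= sp.
Qed.

(** Finite lists exhaust the set: [m] fixes the smallest part d (m + 1), and the total size [N]
    bounds every part and every multiplicity of pi_1. *)
Lemma partition_sum (W : seq nat -> int) :
  \sum_(m < N.+1) \sum_(p <- bparts N.+1 (sizes m) | (d * m.+1)%N \in p)
    \sum_(o <- Os m | sumn p + sz o == N) W p =
  \sum_(pi \in [set pi : seq nat * T |
      [/\ is_partition pi.1, pi.1 != [::] & all (dvdn d) pi.1] /\
      ok (smallest_part pi.1) pi.2 /\ (sumn pi.1 + sz pi.2)%N = N]) W pi.1.
Proof.
pose B m := [seq p <- bparts N.+1 (sizes m) | (d * m.+1)%N \in p].
pose r := [seq po | m <- iota 0 N.+1, po <- [seq (p, o) | p <- B m, o <- Os m]].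
have inB m p o : (m <= N)%N -> (p, o) \in [seq (p, o) | p <- B m, o <- Os m] ->
    [/\ p \in bparts N.+1 (sizes m), (d * m.+1)%N \in p & o \in Os m].
  by move=> _ /allpairsP[[p' o'] /= [+ ? [-> ->]]]; rewrite mem_filter => /andP[].
have uniq_r : uniq r.
  apply: allpairs_uniq_dep; first exact: iota_uniq.
    move=> m _; apply: allpairs_uniq => //; last by move=> [? ?] [? ?] _ _ [-> ->].
    by rewrite filter_uniq // uniq_bparts // sorted_sizes.
  move=> [m1 [p1 o1]] [m2 [p2 o2]] /allpairsPdep[m [[p o] [mN /inB H [-> -> ->]]]].
  move=> /allpairsPdep[m' [[p' o'] [mN' /inB H' [-> -> ->]]]] /= [pp oo].
  rewrite pp oo in H *.
  move: mN mN'; rewrite !mem_iota !add0n !ltnS /= => mN mN'.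
  have [b1 s1 _] := H mN; have [b2 s2 _] := H' mN'.
  (* The smallest part determines [m], so the lists for different [m] are disjoint. *)
  have := smallest_partE mN b1 s1; rewrite (smallest_partE mN' b2 s2) => /eqP.
  by rewrite eqn_mul2l (gtn_eqF d_gt0) /= eqSS => /eqP->.
set A := [set pi : seq nat * T | _]%classic.
have subA po : po \in [seq po <- r | (sumn po.1 + sz po.2 == N)%N] -> A po.
  case: po => p o; rewrite mem_filter => /andP[/= /eqP sN /allpairsPdep[m [[p' o'] [mN]]]].
  move: mN; rewrite mem_iota add0n ltnS /= => mN /(inB m _ _ mN)[pb sp oO] [pp' oo'].
  rewrite {}pp' {}oo' in sN *.
  have := pb; rewrite mem_bparts ?sorted_sizes // => /and3P[sgp /allP psz _].
  have pszE i : i \in p' -> [&& d %| i, d * m.+1 <= i & i <= d * N.+1]%N.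
    by move=> /psz; rewrite inE mem_sizes.
  rewrite /A /=; split; [split|split=> //].
  + rewrite /is_partition sgp; apply/allP => i /pszE /and3P[_ + _].
    by apply: leq_trans; rewrite muln_gt0 d_gt0.
  + by case: (p') sp.
  + by apply/allP => i /pszE /and3P[].
  + by rewrite (smallest_partE mN pb sp) -OsE //; lia.
rewrite (fsbigE [seq po <- r | (sumn po.1 + sz po.2 == N)%N]); first 1 last.
- exact: filter_uniq.
- exact: subA.
- move=> [p o]; rewrite {1}/A /= => -[[/andP[sgp p_gt0] p0 dp] [oko sN]]; case/negP.
  rewrite mem_filter sN eqxx /=.
  have [sp min_p] := smallest_part_min p0; set s := smallest_part p in sp min_p oko.
  have s_gt0 := allP p_gt0 s sp.
  have /dvdnP[[|m] def_s] := allP dp s sp; first by rewrite def_s in s_gt0.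
  rewrite mulnC in def_s.
  have le_p i : i \in p -> (i <= N)%N by move=> /leq_sumn_mem; lia.
  have mN : (m <= N)%N.
    have := le_p s sp; rewrite def_s; apply: leq_trans.
    by apply: leq_trans (leqnSn m) _; rewrite leq_pmull.
  apply/allpairsPdep; exists m, (p, o); split=> //; first by rewrite mem_iota.
  apply/allpairsP; exists (p, o); split=> //=; last by rewrite OsE -?def_s //; lia.
  rewrite mem_filter -def_s sp mem_bparts ?sorted_sizes //=.
  rewrite sgp /=; apply/andP; split; apply/allP => i.
    move=> ip; rewrite inE mem_sizes // -def_s (min_p i ip) (allP dp i ip) /=.
    by apply: leq_trans (le_p i ip) _; apply: leq_trans (leqnSn N) _; rewrite leq_pmull.
  by move=> _; rewrite ltnS; apply: leq_trans (leq_count_sumn p_gt0 i) _; lia.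
rewrite [RHS]big_seq_cond (eq_bigl (fun po => po \in [seq po <- r | (sumn po.1 + sz po.2 == N)%N])).
  rewrite -big_seq big_filter [RHS]big_mkcond /r [RHS]big_allpairs_dep /= -(big_mkord xpredT (fun m =>
    \sum_(p <- bparts N.+1 (sizes m) | (d * m.+1)%N \in p)
      \sum_(o <- Os m | sumn p + sz o == N) W p)).
  rewrite /index_iota subn0; apply: eq_bigr => m _.
  rewrite big_allpairs_dep big_filter; apply: eq_bigr => p _.
  by rewrite -big_mkcond.
by move=> po /=; apply: andb_idr => por; rewrite mem_set //; apply: subA.
Qed.

End PartitionSum.

(** * Generating functions of weighted partitions *)

Section GeneratingFunction.
Variable S : comNzRingType.

Lemma fpsC_nmod : nmod_morphism (@fpsC S).
Proof.
split=> // a b; apply/funext => n; rewrite fpsDE /fpsC.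
by case: eqP => _; rewrite ?addr0.
Qed.

Lemma fpsCM (c : S) (f : fps S) n : (fpsC c * f) n = c * f n.
Proof.
rewrite fpsME big_ord_recl subn0 /fpsC /= big1 ?addr0 // => i _.
by rewrite mul0r.
Qed.

Lemma fpsC_monoid : monoid_morphism (@fpsC S).
Proof.
split=> // a b; apply/funext => n; rewrite fpsCM /fpsC.
by case: eqP => _; rewrite ?mulr0.
Qed.

HB.instance Definition _ :=
  GRing.isNmodMorphism.Build S (fps S) (@fpsC S) fpsC_nmod.
HB.instance Definition _ :=
  GRing.isMonoidMorphism.Build S (fps S) (@fpsC S) fpsC_monoid.

Lemma fpsXn n i : (@fpsX S ^+ n) i = (i == n)%:R.
Proof.
elim: n i => [|n IHn] i; first by rewrite expr0; case: i.
rewrite exprS fpsME; case: i => [|i].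
  by rewrite big_ord1 /fpsX /= mul0r.
rewrite !big_ord_recl /= big1 => [|j _]; last by rewrite /fpsX /= mul0r.
by rewrite /fpsX /= mul0r mul1r add0r addr0 subSS subn0 IHn.
Qed.

Variables (t : fps S).
Implicit Types Y : fps S.

(** Both weight sequences obey w_(f+1) = (2 + t) w_f - w_(f-1), and D(Y) = 1 - (2 + t) Y + Y^2;
    multiplying by D leaves initial terms and a tail starting at Y^F. For F > 0 the difference
    [weightB t F - weightA t F] is the preceding value of [weightB]. *)
Lemma sum_weightB Y F : (\sum_(0 <= f < F) weightB t f * Y ^+ f) * zfactor t Y =
  (1 - Y) - Y ^+ F * (weightB t F - Y * (weightB t F - weightA t F)).
Proof.
elim: F => [|F IHF]; first by rewrite big_nil expr0 /weightA /weightB /=; ring.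
rewrite big_nat_recr //= mulrDl IHF weightBS weightAS exprS /zfactor; ring.
Qed.

Lemma sum_weightA Y F : (\sum_(0 <= f < F) weightA t f * Y ^+ f) * zfactor t Y =
  t * Y - Y ^+ F * ((1 - Y) * weightA t F - t * Y * weightA t F + t * Y * weightB t F).
Proof.
elim: F => [|F IHF]; first by rewrite big_nil expr0 /weightA /weightB /=; ring.
rewrite big_nat_recr //= mulrDl IHF weightBS weightAS exprS /zfactor; ring.
Qed.

Lemma sum_weightB_mod Y F : ordge 1 Y ->
  ordge F (\sum_(0 <= f < F) weightB t f * Y ^+ f - (1 - Y) / zfactor t Y).
Proof.
move=> HY; have u := const1_unit (const1_zfactor t HY).
rewrite -[X in X - _](mulrK u) sum_weightB -mulrBl; apply: ordgeMr.
by rewrite addrAC subrr sub0r; apply: ordgeN; apply: ordgeMr; apply: ordgeX.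
Qed.

Lemma sum_weightA_mod Y F : ordge 1 Y ->
  ordge F (\sum_(0 <= f < F) weightA t f * Y ^+ f - t * Y / zfactor t Y).
Proof.
move=> HY; have u := const1_unit (const1_zfactor t HY).
rewrite -[X in X - _](mulrK u) sum_weightA -mulrBl; apply: ordgeMr.
by rewrite addrAC subrr sub0r; apply: ordgeN; apply: ordgeMr; apply: ordgeX.
Qed.

Variables (d N : nat) (e0 e1 C : fps S).
Hypotheses (d_gt0 : (0 < d)%N) (He0 : ordge 1 e0) (He1 : ordge 1 e1).
Let q := @fpsX S.
Let x := q ^+ d.

Lemma ordge_qX n : (0 < n)%N -> ordge 1 (q ^+ n).
Proof. by move=> n0; apply: (ordge_le n0); apply: ordgeX; apply: ordge_fpsX. Qed.

Let Hx : ordge 1 x. Proof. exact: ordge_qX. Qed.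

Hypothesis HC : forall M, ordge M (C - gauss_prod x e0 e1 M * qpoch x x M / zprod x t M).

Definition part_weight m j f : fps S :=
  if j == (d * m.+1)%N then weightA t f else weightB t f.

Lemma prod_div_mul I (r : seq I) (a b : I -> fps S) : (forall i, b i \is a GRing.unit) ->
  \prod_(i <- r) (a i / b i) * \prod_(i <- r) b i = \prod_(i <- r) a i.
Proof. by move=> ub; rewrite -big_split /=; apply: eq_bigr => i _; rewrite divrK. Qed.

(** [O] generates the remaining components, assumed to amount to the quotient of [gauss_prod] at N +
    1 and m + 1. Modulo q^(N+1) each multiplicity sum is a closed quotient and [C] may be cut off at
    N + 1, so that both sides become the finite product [L]. *)
Lemma genfun_term m (O : fps S) : (m <= N)%N ->
  ordge N.+1 (O * gauss_prod x e0 e1 m.+1 - gauss_prod x e0 e1 N.+1) ->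
  ordge N.+1 (t * C * (x ^+ m.+1 * zprod x t m / (qpoch x x m.+1 * gauss_prod x e0 e1 m.+1))
    - \sum_(p <- bparts N.+1 (sizes d N m))
        (\prod_(j <- sizes d N m) part_weight m j (count_mem j p)) * q ^+ sumn p * O).
Proof.
move=> le_mN HO; set G := gauss_prod x e0 e1.
have uG n : G n \is a GRing.unit := const1_unit (const1_gauss_prod x He0 He1 n).
have uq n := const1_unit (const1_qpoch1 Hx n).
have uz n := const1_unit (const1_zprod t Hx n).
have ud n : zfactor t (x ^+ n.+1) \is a GRing.unit.
  by apply/const1_unit/const1_zfactor; apply: ordge_expS.
rewrite -mulr_suml bparts_sum; last first.
  by apply: (sorted_uniq ltn_trans ltnn); apply: sorted_sizes.
rewrite sizes_cons // big_cons big_map.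
pose L := t * x ^+ m.+1 / zfactor t (x ^+ m.+1) *
   \prod_(m.+1 <= j < N.+1) ((1 - x ^+ j.+1) / zfactor t (x ^+ j.+1)) * (G N.+1 / G m.+1).
have cong_R : ordge N.+1 ((\sum_(0 <= f < N.+1) part_weight m (d * m.+1) f * q ^+ (d * m.+1 * f)) *
   (\prod_(m.+1 <= j < N.+1)
      \sum_(0 <= f < N.+1) part_weight m (d * j.+1) f * q ^+ (d * j.+1 * f)) * O - L).
  have qX j : q ^+ (d * j.+1) = x ^+ j.+1 by rewrite exprM.
  apply: eqordM; last first.
    rewrite -[X in X - _](mulrK (uG m.+1)) -mulrBl; apply: ordgeMr; exact: HO.
  apply: eqordM.
    rewrite (eq_bigr (fun f => weightA t f * (x ^+ m.+1) ^+ f)) => [|f _].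
      by apply: sum_weightA_mod; apply: ordge_expS.
    by rewrite /part_weight eqxx exprM qX.
  rewrite big_nat_cond [X in _ - X]big_nat_cond; apply: eqord_prod => j /andP[/andP[mj _] _].
  rewrite (eq_bigr (fun f => weightB t f * (x ^+ j.+1) ^+ f)) => [|f _].
    by apply: sum_weightB_mod; apply: ordge_expS.
  by rewrite /part_weight eqn_mul2l eqSS !gtn_eqF // exprM qX.
apply: eqord_trans; last by apply: eqord_sym; apply: cong_R.
have cong_C : ordge N.+1 (t * C * (x ^+ m.+1 * zprod x t m / (qpoch x x m.+1 * G m.+1)) -
   t * (G N.+1 * qpoch x x N.+1 / zprod x t N.+1) *
     (x ^+ m.+1 * zprod x t m / (qpoch x x m.+1 * G m.+1))).
  by rewrite -mulrBl -mulrBr; apply: ordgeMr; apply: ordgeMl; apply: HC.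
apply: eqord_trans cong_C _; rewrite (_ : _ - _ = 0); first by move=> i _; apply: fps0E.
apply/eqP; rewrite subr_eq0; apply/eqP.
pose PD := \prod_(m.+1 <= j < N.+1) zfactor t (x ^+ j.+1).
pose PX := \prod_(m.+1 <= j < N.+1) (1 - x ^+ j.+1).
have uPD : PD \is a GRing.unit by apply: rpred_prod.
have defPX : \prod_(m.+1 <= j < N.+1) ((1 - x ^+ j.+1) / zfactor t (x ^+ j.+1)) = PX / PD.
  by apply: (mulIr uPD); rewrite prod_div_mul // divrK.
have defq : qpoch x x N.+1 = qpoch x x m.+1 * PX.
  rewrite /qpoch (big_cat_nat (n := m.+1)) //=; congr (_ * _).
  by apply: eq_bigr => j _; rewrite exprS.
have defz : zprod x t N.+1 = zprod x t m * zfactor t (x ^+ m.+1) * PD.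
  by rewrite /zprod (big_cat_nat (n := m.+1)) //= big_nat_recr.
rewrite /L defPX defq defz !invrM ?unitrM ?uG ?uq ?uz ?ud //.
pose Q := qpoch x x m.+1; pose Z := zprod x t m; rewrite -/Q -/Z.
transitivity (t * x ^+ m.+1 / zfactor t (x ^+ m.+1) * (PX / PD) * (G N.+1 / G m.+1)
              * ((Q / Q) * (Z / Z))); first by ring.
by rewrite !divrr ?uq ?uz // !mulr1.
Qed.

End GeneratingFunction.

(** * Moments as coefficients of powers of t *)

Section Moment.

(** [moment] is additive but not multiplicative, so products of weights are formed as integer
    polynomials, whose coefficients it reads off after evaluation at [tz]. *)
Definition poly_tz : {poly int} -> laurent int :=
  horner_eval tz \o map_poly (intr : int -> laurent int).

HB.instance Definition _ := GRing.RMorphism.on poly_tz.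

Lemma poly_tzX : poly_tz 'X = tz.
Proof. by rewrite /poly_tz /= map_polyX /horner_eval hornerX. Qed.

Lemma moment_poly_tz k (P : {poly int}) : moment k (poly_tz P) = P`_k.
Proof.
rewrite -[P in LHS]coefK poly_def !raddf_sum /=.
under eq_bigr => i _.
  rewrite /poly_tz /= map_polyZ map_polyXn /horner_eval hornerZ hornerXn.
  rewrite mulrzl raddfMz /= moment_tzX -mulrzr mulr_natl mulrb.
  over.
rewrite -big_mkcond /=; have [le_Pk|lt_kP] := leqP (size P) k.
  by rewrite nth_default // big1 // => i /eqP ik; have := ltn_ord i; rewrite ik ltnNge le_Pk.
by rewrite (big_pred1 (Ordinal lt_kP)) // intz.
Qed.

Variables (d N : nat) (T : choiceType) (sz : T -> nat).
Variables (Os : nat -> seq T) (ok : nat -> pred T).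
Hypothesis d_gt0 : (0 < d)%N.
Hypothesis uniq_Os : forall m, uniq (Os m).
Hypothesis OsE : forall m o, (sz o <= N)%N -> (o \in Os m) = ok (d * m.+1) o.

Local Notation q := (@fpsX (laurent int)).
Local Notation t := (fpsC tz).
Variables (e0 e1 C : fps (laurent int)).
Let x := q ^+ d.
Hypotheses (He0 : ordge 1 e0) (He1 : ordge 1 e1).
Hypothesis HC : forall M, ordge M (C - gauss_prod x e0 e1 M * qpoch x x M / zprod x t M).
Hypothesis gf_Os : forall m, (m <= N)%N -> ordge N.+1
  ((\sum_(o <- Os m) q ^+ sz o) * gauss_prod x e0 e1 m.+1 - gauss_prod x e0 e1 N.+1).

Definition part_poly m j f : {poly int} :=
  if j == (d * m.+1)%N then weightA 'X f else weightB 'X f.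

Lemma part_weight_poly m j f : part_weight t d m j f = fpsC (poly_tz (part_poly m j f)).
Proof.
rewrite /part_weight /part_poly -poly_tzX.
have [A B] := rmorph_weight (@fpsC (laurent int)) (poly_tz 'X) f.
have [A' B'] := rmorph_weight poly_tz 'X f.
by case: eqP => _; rewrite -?A -?A' -?B -?B'.
Qed.

(** Larger sizes absent from [p] drop out because [weightB] is 1 at multiplicity 0, whereas
    [weightA] is 0 there and removes every [p] lacking the prescribed smallest part. *)
Lemma coef_part_poly k m p : (0 < k)%N -> (m <= N)%N -> p \in bparts N.+1 (sizes d N m) ->
  (\prod_(j <- sizes d N m) part_poly m j (count_mem j p))`_k =
  if (d * m.+1)%N \in p then omega k p else 0.
Proof.
move=> k0 le_mN pb; have := distinct_parts_bparts (sorted_sizes N d_gt0 m) pb.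
rewrite sizes_cons // big_cons {1}/part_poly eqxx; set L := larger_sizes _ _ _.
have tail : \prod_(j <- L) part_poly m j (count_mem j p) =
            \prod_(j <- L | j \in p) weightB 'X (count_mem j p).
  rewrite [RHS]big_mkcond; apply: eq_big_seq => j /mapP[i].
  rewrite mem_index_iota => /andP[mi _] ->; rewrite /part_poly eqn_mul2l eqSS !gtn_eqF //=.
  by case: ifP => // /negbT /count_memPn ->.
rewrite tail /=; case: ifP => [sp dp|/negbT /count_memPn -> _].
  rewrite omegaE //; last by case: (p) sp.
  by rewrite /mult dp /= big_filter.
by rewrite mul0r coef0.
Qed.

Lemma moment_genfun k : (0 < k)%N ->
  moment k ((C - osum (fun n => gauss_num x e0 e1 n / zprod x t n)) N) =
  \sum_(pi \in [set pi : seq nat * T |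
      [/\ is_partition pi.1, pi.1 != [::] & all (dvdn d) pi.1] /\
      ok (smallest_part pi.1) pi.2 /\ (sumn pi.1 + sz pi.2)%N = N]) omega k pi.1.
Proof.
move=> k0; have Hx : ordge 1 x by apply: ordge_qX.
rewrite (rank_crank Hx He0 He1 HC) -(partition_sum d_gt0 uniq_Os OsE) /osum raddf_sum.
apply: eq_bigr => -[m /= le_mN] _; rewrite ltnS in le_mN.
(* Coefficient [N] depends only on the class modulo q^(N+1). *)
have /eqordP/(_ N (leqnn _)) -> := genfun_term d_gt0 He0 He1 HC le_mN (gf_Os le_mN).
rewrite fps_sumE raddf_sum [RHS]big_mkcond; apply: eq_big_seq => p pb.
under eq_bigr do rewrite part_weight_poly.
rewrite -!rmorph_prod -mulrA fpsCM [_ ^+ _ * _]mulr_sumr fps_sumE mulr_sumr raddf_sum.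
rewrite [RHS](_ : _ = \sum_(o <- Os m | sumn p + sz o == N)
   if (d * m.+1)%N \in p then omega k p else 0); last first.
  by case: ifP => // _; rewrite big1.
rewrite [RHS]big_mkcond; apply: eq_bigr => o _.
rewrite -exprD fpsXn eq_sym -(coef_part_poly k0 le_mN pb) -moment_poly_tz.
by case: eqP => _; rewrite ?mulr1 // mulr0 raddf0.
Qed.

End Moment.

(** * The remaining components *)

Section ShiftedParts.
Variables (d : nat).
Hypothesis d_gt0 : (0 < d)%N.

(** The sizes congruent to 1 modulo [d]: odd numbers for d = 2, all positive integers for d = 1.
    From index [a] on they exceed d a, the bound set by a smallest part. *)
Definition shifted_sizes a b : seq nat := [seq (d * i).+1 | i <- index_iota a b]%N.

Lemma sorted_shifted_sizes a b : sorted ltn (shifted_sizes a b).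
Proof.
rewrite sorted_map; apply: sub_sorted (iota_ltn_sorted _ _) => i j /= ltij.
by rewrite /= ltnS ltn_mul2l d_gt0.
Qed.

Lemma mem_shifted_sizes a b i :
  (i \in shifted_sizes a b) = [&& 0 < i, d %| i.-1, d * a < i & i <= d * b]%N.
Proof.
apply/mapP/and4P => [[j]|[]].
  by rewrite mem_index_iota => /andP[aj jb] ->; rewrite /= dvdn_mulr // (ltnS (d * a)) leq_mul2l aj orbT ltn_mul2l d_gt0.
case: i => // i _ /= /dvdnP[j ->]; rewrite (mulnC j) ltnS leq_mul2l ltn_mul2l (gtn_eqF d_gt0) d_gt0 /=.
by move=> aj jb; exists j => //; rewrite mem_index_iota aj.
Qed.

Lemma all_shifted_sizes a b p : (sumn p <= d * b)%N ->
  all (mem (shifted_sizes a b)) p =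
  [&& all (fun i => 0 < i)%N p, all (fun i => d %| i.-1)%N p & all (fun i => d * a < i)%N p].
Proof.
move=> le_p; rewrite -!all_predI; apply: eq_in_all => i ip.
rewrite inE mem_shifted_sizes /= (leq_trans (leq_sumn_mem ip) le_p) andbT.
by rewrite andbA.
Qed.

Lemma mem_distinct_bparts a b p : (sumn p <= d * b)%N ->
  (p \in bparts 2 (shifted_sizes a b)) =
  [&& is_partition p, uniq p, all (fun i => d %| i.-1)%N p & all (fun i => d * a < i)%N p].
Proof.
move=> le_p; rewrite mem_bparts ?sorted_shifted_sizes // (all_shifted_sizes a le_p) /is_partition.
case: (boolP (sorted geq p)) => //= _.
case: (boolP (all _ p)) => //= p0.
case: (boolP (all _ p)) => [dp|_]; last by rewrite andbF.
case: (boolP (all _ p)) => [ap|_]; last by rewrite !andbF.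
rewrite !andbT; apply/allP/idP => [c|up i _]; last first.
  by rewrite count_uniq_mem //; case: (i \in p).
apply: count_mem_uniq => i; case: (boolP (i \in p)) => [ip|/count_memPn//].
have : (0 < count_mem i p)%N by rewrite -has_count has_pred1.
have := all_shifted_sizes a le_p; rewrite p0 dp ap => /allP/(_ i ip) /c /=.
by case: (count_mem i p) => [|[|]].
Qed.

Lemma mem_any_bparts N a b p : (sumn p <= d * b)%N -> (sumn p <= N)%N ->
  (p \in bparts N.+1 (shifted_sizes a b)) =
  [&& is_partition p, all (fun i => d %| i.-1)%N p & all (fun i => d * a < i)%N p].
Proof.
move=> le_p leN; rewrite mem_bparts ?sorted_shifted_sizes // (all_shifted_sizes a le_p) /is_partition.
case: (boolP (sorted geq p)) => //= _.
case: (boolP (all _ p)) => //= p0; rewrite andbC andb_idl // => _.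
by apply/allP => i _; rewrite ltnS (leq_trans (leq_count_sumn p0 i)).
Qed.

Variable S : comNzRingType.
Local Notation q := (@fpsX S).

Lemma sum_distinct_bparts a b : (a <= b)%N ->
  (\sum_(p <- bparts 2 (shifted_sizes a b)) q ^+ sumn p) * qpoch (- q) (q ^+ d) a
  = qpoch (- q) (q ^+ d) b.
Proof.
move=> ab; rewrite (eq_bigr (fun p => (\prod_(j <- shifted_sizes a b) 1) * q ^+ sumn p)); last first.
  by move=> p _; rewrite big1_eq mul1r.
rewrite (bparts_sum (fun _ _ => 1)); last first.
  by apply: (sorted_uniq ltn_trans ltnn); apply: sorted_shifted_sizes.
rewrite [RHS](@big_cat_nat _ _ _ a) //= mulrC; congr (_ * _).
rewrite big_map; apply: eq_bigr => i _.
rewrite big_nat_recr //= big_nat1 muln0 muln1 expr0 !mulr1 mul1r mulNr opprK.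
by rewrite exprS -exprM.
Qed.

(** Each size contributes a truncated geometric series, whose product with 1 - Y is 1 - Y^(N+1);
    hence a congruence, where distinct parts give an equality. *)
Lemma sum_any_bparts N a b : (a <= b)%N ->
  ordge N.+1 ((\sum_(p <- bparts N.+1 (shifted_sizes a b)) q ^+ sumn p) * qpoch q (q ^+ d) b
   - qpoch q (q ^+ d) a).
Proof.
move=> ab; rewrite (eq_bigr (fun p => (\prod_(j <- shifted_sizes a b) 1) * q ^+ sumn p)); last first.
  by move=> p _; rewrite big1_eq mul1r.
rewrite (bparts_sum (fun _ _ => 1)); last first.
  by apply: (sorted_uniq ltn_trans ltnn); apply: sorted_shifted_sizes.
rewrite {1}/qpoch (@big_cat_nat _ _ _ a) //= -/(qpoch _ _ a) mulrCA -[X in _ - X]mulr1 -mulrBr.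
apply: ordgeMl; rewrite big_map -big_split /=.
rewrite [X in _ - X](_ : _ = \prod_(i <- index_iota a b) 1); last by rewrite big1_eq.
apply: eqord_prod => i _.
rewrite -exprM -exprS; set Y := q ^+ _.
have HY : ordge 1 Y by apply: ordge_qX.
have -> : \sum_(0 <= f < N.+1) 1 * q ^+ ((d * i).+1 * f) = \sum_(0 <= f < N.+1) Y ^+ f.
  by apply: eq_bigr => f _; rewrite mul1r exprM.
have -> : (\sum_(0 <= f < N.+1) Y ^+ f) * (1 - Y) - 1 = - Y ^+ N.+1.
  rewrite big_mkord; have := subrX1 Y N.+1; set s := \sum_(i < _) _ => E.
  by transitivity (- ((Y - 1) * s) - 1); [ring | rewrite -E; ring].
by apply: ordgeN; apply: ordgeX.
Qed.

End ShiftedParts.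

(** * The three pairs of functions *)

Section GaussSpecializations.
Variables (S : comNzRingType) (q : fps S).

Lemma gauss_prod_distinct x M : gauss_prod x 0 (- q) M = qpoch (- q) x M.
Proof.
apply: eq_bigr => i _; rewrite !mul0r addr0 subr0 divr1.
by [].
Qed.

(** With X = q^(2n), consecutive terms have quotient q X (1 + q X) = q X + q^2 X^2. *)
Lemma gauss_num_M2 n :
  q ^+ (n ^ 2) * qpoch (- q) (q ^+ 2) n = gauss_num (q ^+ 2) 0 (- q) n.
Proof.
elim: n => [|n IHn]; first by rewrite gauss_num0 qpoch0 mulr1.
rewrite gauss_numS -IHn qpochS.
have -> : (n.+1 ^ 2 = n ^ 2 + (2 * n).+1)%N by lia.
by rewrite exprD (exprS q (2 * n)) (exprM q 2 n); ring.
Qed.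

Lemma gauss_num_bar n :
  qpoch (- 1) q n * q ^+ (n * n.+1)./2 = gauss_num q 0 (- q) n.
Proof.
elim: n => [|n IHn]; first by rewrite gauss_num0 qpoch0 mulr1.
have -> : (n.+1 * n.+2)./2 = ((n * n.+1)./2 + n.+1)%N by lia.
rewrite gauss_numS -IHn qpochS.
by rewrite exprD (exprS q n); ring.
Qed.

(** With X = q^(2n), consecutive terms have quotient q (1 + X) (1 + q X), from which e0 and e1 are
    read off. *)
Lemma gauss_num_2bar n :
  q ^+ n * qpoch (- 1) q (2 * n) = gauss_num (q ^+ 2) q (- q - q ^+ 2) n.
Proof.
elim: n => [|n IHn]; first by rewrite gauss_num0 qpoch0 mulr1.
rewrite gauss_numS -IHn mulnS !addSn add0n !qpochS.
by rewrite (exprS q n) (exprS q (2 * n)) (exprM q 2 n); ring.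
Qed.

Hypothesis Hq : ordge 1 q.

(** The numerators factor as (1 + q X) (1 + q^2 X) with X = q^(2i), hence the doubled length of the
    first product. *)
Lemma gauss_prod_2bar n :
  gauss_prod (q ^+ 2) q (- q - q ^+ 2) n = qpoch (- q) q (2 * n) / qpoch q (q ^+ 2) n.
Proof.
have u m : qpoch q (q ^+ 2) m \is a GRing.unit.
  by apply: const1_unit; apply: const1_qpoch.
elim: n => [|n IHn]; first by rewrite gauss_prod0 !qpoch0 divr1.
have := u n.+1; rewrite qpochS unitrM => /andP[un us].
rewrite gauss_prodS IHn invrM //.
rewrite mulnS !addSn add0n !qpochS (exprS q (2 * n)) (exprM q 2 n); set D := (_ - _)^-1; ring.
Qed.

End GaussSpecializations.

Lemma divrMM (A : comUnitRingType) (a b c e f : A) :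
  c \is a GRing.unit -> e * f \is a GRing.unit -> a * b / (c * e * f) = a / c * b / (e * f).
Proof. by move=> uc uef; rewrite -[c * e * f]mulrA invrM //; ring. Qed.

Lemma subr_divV (A : comUnitRingType) (a b c : A) :
  b \is a GRing.unit -> c \is a GRing.unit ->
  a / b - c^-1 = (a * c - b) * (b^-1 * c^-1).
Proof. by move=> ub uc; rewrite mulrBl mulrACA [b * _]mulrA !divrr // mulr1 mul1r. Qed.

Section RankCrankFunctions.

Local Notation t := (fpsC tz).

(** The inverse on [fps] is defined by choice; uniqueness of inverses identifies it with the
    monomial. *)
Lemma zVE : z^-1 = fpsC (<< (-1 : int) >> : laurent int).
Proof.
have uz : z \is a GRing.unit by apply/unitrPr; eexists; apply: zV.
by apply: (mulrI uz); rewrite zV mulrV.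
Qed.

Lemma zfactorE (y : fps (laurent int)) : (1 - z * y) * (1 - z^-1 * y) = zfactor t y.
Proof.
rewrite zVE /zfactor /tz rmorphB rmorphD rmorph_nat /= -/z; have := zV.
set b := fpsC (<< (-1 : int) >> : laurent int) => ab.
transitivity (1 - (z + b) * y + (z * b) * y ^+ 2); first by ring.
rewrite ab; ring.
Qed.

Lemma qpoch_z x n : qpoch (z * x) x n * qpoch (z^-1 * x) x n = zprod x t n.
Proof.
rewrite /qpoch -big_split; apply: eq_bigr => j _ /=.
by rewrite -!mulrA -exprS zfactorE.
Qed.

Lemma qpochoo_z_mod x n : ordge 1 x ->
  ordge n (qpochoo (z * x) x * qpochoo (z^-1 * x) x - zprod x t n).
Proof. by move=> Hx; rewrite -qpoch_z; apply: eqordM; apply: qpochoo_mod. Qed.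

Lemma crank_mod x A B M : ordge 1 x -> ordge M (A - B) ->
  ordge M (A * qpochoo x x / (qpochoo (z * x) x * qpochoo (z^-1 * x) x)
           - B * qpoch x x M / zprod x t M).
Proof.
move=> Hx HA; apply: eqordM; first by apply: eqordM => //; apply: qpochoo_mod.
apply: eqordV; last exact: qpochoo_z_mod.
  by apply: const1M; apply: const1_qpochoo => //; apply: ordgeMl.
exact: const1_zprod.
Qed.

Lemma rank_osum x e0 e1 (A : nat -> fps (laurent int)) :
  ordge 1 x -> ordge 1 e0 -> ordge 1 e1 -> A =1 gauss_num x e0 e1 ->
  fps_series (fun n => A n / (qpoch (z * x) x n * qpoch (z^-1 * x) x n)) =
  osum (fun n => gauss_num x e0 e1 n / zprod x t n).
Proof.
move=> Hx He0 He1 HA.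
rewrite fps_series_osum => [|n]; last by rewrite HA; apply: ordgeMr; apply: ordge_gauss_num.
by apply: eq_osum => n; rewrite HA qpoch_z.
Qed.

Lemma fsum_coefB k n (C D : fps (laurent int)) :
  \sum_(m \in [set: int]) bk k m * (coef C m n - coef D m n) = moment k ((C - D) n).
Proof.
by rewrite -fsum_moment; apply: eq_fsbigr => m _; rewrite /coef -mcoeffB.
Qed.

Lemma ordge_q : ordge 1 q. Proof. exact: ordge_fpsX. Qed.

(** Serves the first two identities: d = 2 for [S2] and d = 1 for [Sbar]. For positive parts the
    condition on [i.-1] means oddness when d = 2 and is vacuous when d = 1. *)
Lemma moment_distinct d N k (C : fps (laurent int)) : (0 < d)%N -> (0 < k)%N ->
  C = qpochoo (- q) (q ^+ d) * qpochoo (q ^+ d) (q ^+ d) /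
    (qpochoo (z * q ^+ d) (q ^+ d) * qpochoo (z^-1 * q ^+ d) (q ^+ d)) ->
  moment k ((C - osum (fun n => gauss_num (q ^+ d) 0 (- q) n / zprod (q ^+ d) t n)) N) =
  \sum_(pi \in [set pi : seq nat * seq nat |
      [/\ is_partition pi.1, pi.1 != [::] & all (dvdn d) pi.1] /\
      [&& is_partition pi.2, uniq pi.2, all (fun i => d %| i.-1)%N pi.2 &
          all (fun i => smallest_part pi.1 < i)%N pi.2] /\
      (sumn pi.1 + sumn pi.2)%N = N]) omega k pi.1.
Proof.
move=> d0 k0 ->; have Hx : ordge 1 (q ^+ d) by apply: ordge_qX.
have He1 : ordge 1 (- q) by apply: ordgeN; apply: ordge_q.
have He0 : ordge 1 (0 : fps (laurent int)) by move=> i _; apply: fps0E.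
apply: (moment_genfun (Os := fun m => bparts 2 (shifted_sizes d m.+1 N.+1))
  (ok := fun s p => [&& is_partition p, uniq p, all (fun i => d %| i.-1)%N p &
          all (fun i => s < i)%N p]) d0 _ _ He0 He1 _ _ k0).
- by move=> m; apply: uniq_bparts; apply: sorted_shifted_sizes.
- move=> m o le_oN; apply: mem_distinct_bparts => //; nia.
- by move=> M; rewrite gauss_prod_distinct; apply: crank_mod => //; apply: qpochoo_mod.
- move=> m le_mN; rewrite !gauss_prod_distinct sum_distinct_bparts //; exact: eqord_refl.
Qed.

Lemma moment_2bar N k (C : fps (laurent int)) : (0 < k)%N ->
  C = qpochoo (- q) q * qpochoo (q ^+ 2) (q ^+ 2) /
    (qpochoo q (q ^+ 2) *
     qpochoo (z * q ^+ 2) (q ^+ 2) * qpochoo (z^-1 * q ^+ 2) (q ^+ 2)) ->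
  moment k ((C - osum (fun n => gauss_num (q ^+ 2) q (- q - q ^+ 2) n / zprod (q ^+ 2) t n)) N) =
  \sum_(pi \in [set pi : seq nat * (seq nat * seq nat) |
      [/\ is_partition pi.1, pi.1 != [::] & all (dvdn 2) pi.1] /\
      [&& [&& is_partition pi.2.1, all (fun i => 2 %| i.-1)%N pi.2.1 &
          all (fun i => smallest_part pi.1 < i)%N pi.2.1] &
          [&& is_partition pi.2.2, uniq pi.2.2, all (fun i => 1 %| i.-1)%N pi.2.2 &
          all (fun i => smallest_part pi.1 < i)%N pi.2.2]] /\
      (sumn pi.1 + (sumn pi.2.1 + sumn pi.2.2))%N = N]) omega k pi.1.
Proof.
move=> k0 defC; have Hx : ordge 1 (q ^+ 2) by apply: ordge_qX.
have Hq := ordge_q.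
have prodE := gauss_prod_2bar Hq.
have Hnq : ordge 1 (- q) by apply: ordgeN.
have He1 : ordge 1 (- q - q ^+ 2) by apply: ordge_sub.
have uE n : qpoch q (q ^+ 2) n \is a GRing.unit by apply: const1_unit; apply: const1_qpoch.
have uoo : const1 (qpochoo q (q ^+ 2)) by apply: const1_qpochoo.
rewrite divrMM in defC; last 2 first.
- exact: const1_unit.
- have Hz c : ordge 1 (c * q ^+ 2) by apply: ordgeMl.
  exact: const1_unit (const1M (const1_qpochoo (Hz z) Hx) (const1_qpochoo (Hz z^-1) Hx)).
(* Both lists start just above 2 (m + 1); the distinct parts run to 2 (N + 1) so that their product
   matches (-q; q)_(2(N+1)) in [gauss_prod_2bar]. *)
apply: (moment_genfun
  (sz := fun o => (sumn o.1 + sumn o.2)%N)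
  (Os := fun m => [seq (a, b) | a <- bparts N.+1 (shifted_sizes 2 m.+1 N.+1),
                                b <- bparts 2 (shifted_sizes 1 (2 * m.+1) (2 * N.+1))])
  (ok := fun s o => [&& [&& is_partition o.1, all (fun i => 2 %| i.-1)%N o.1 &
          all (fun i => s < i)%N o.1] &
          [&& is_partition o.2, uniq o.2, all (fun i => 1 %| i.-1)%N o.2 &
          all (fun i => s < i)%N o.2]]) (d := 2) isT _ _ Hq He1 _ _ k0).
- move=> m; apply: allpairs_uniq; last by move=> [? ?] [? ?] _ _ [-> ->].
    by apply: uniq_bparts; apply: sorted_shifted_sizes.
  by apply: uniq_bparts; apply: sorted_shifted_sizes.
- move=> m [a b] /= le_oN.
  have leb : (sumn b <= 1 * (2 * N.+1))%N by lia.
  have lea : (sumn a <= 2 * N.+1)%N by lia.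
  have leN : (sumn a <= N)%N by lia.
  have := mem_distinct_bparts (d := 1) isT (2 * m.+1) leb; rewrite mul1n => <-.
  rewrite -(mem_any_bparts (d := 2) isT m.+1 lea leN).
  apply/allpairsP/andP => [[[a' b'] /= [? ? [-> ->]]] //|[? ?]].
  by exists (a, b).
- move=> M; rewrite prodE {}defC.
  apply: (@crank_mod (q ^+ 2) (qpochoo (- q) q / qpochoo q (q ^+ 2))
    (qpoch (- q) q (2 * M) / qpoch q (q ^+ 2) M) M Hx).
  apply: eqordM.
    apply: (@ordge_le _ M (2 * M)); first by rewrite leq_pmull.
    exact: qpochoo_mod.
  by apply: eqordV => //; [apply: const1_qpoch | apply: qpochoo_mod].
- move=> m le_mN; rewrite !prodE big_allpairs_dep /=.
  under eq_bigr do under eq_bigr do rewrite exprD.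
  under eq_bigr do rewrite -mulr_sumr.
  rewrite -mulr_suml -/q.
  have distinct := @sum_distinct_bparts 1 isT (laurent int) (2 * m.+1) (2 * N.+1).
  have any := @sum_any_bparts 2 isT (laurent int) N m.+1 N.+1 le_mN.
  set a := \sum_(p <- _) _ in any *; set b := \sum_(p <- _) _ in distinct *.
  rewrite (mulrC a b) mulrACA -(expr1 q) distinct ?expr1; last by rewrite leq_mul2l /= ltnS (leq_trans le_mN).
  rewrite -mulrBr; apply: ordgeMl.
  rewrite subr_divV; [|exact: uE|exact: uE].
  by apply: ordgeMr; apply: any.
Qed.

End RankCrankFunctions.

(** * The sets of vector partitions in the theorem *)

Lemma all_dvdn2 p : all (dvdn 2) p = all (fun x => ~~ odd x) p.
Proof. by apply: eq_all => i; rewrite dvdn2. Qed.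

Lemma all_odd_pred p : is_partition p -> all (fun i => 2 %| i.-1)%N p = all odd p.
Proof.
case/andP=> _ /allP p0; apply: eq_in_all => i /p0; case: i => // i _ /=.
by rewrite dvdn2.
Qed.

Lemma all_dvdn1 (f : nat -> nat) p : all (fun i => 1 %| f i)%N p.
Proof. by apply/allP => i _; rewrite dvd1n. Qed.

Lemma S2_genfun_set n :
  [set pi | S2 pi /\ size2 pi = n]%classic = [set pi : seq nat * seq nat |
      [/\ is_partition pi.1, pi.1 != [::] & all (dvdn 2) pi.1] /\
      [&& is_partition pi.2, uniq pi.2, all (fun i => 2 %| i.-1)%N pi.2 &
          all (fun i => smallest_part pi.1 < i)%N pi.2] /\
      (sumn pi.1 + sumn pi.2)%N = n]%classic.
Proof.
apply/funext => -[p o]; apply/propext; rewrite /S2 /size2 /= all_dvdn2; split.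
  by move=> [[[? ? ?] [po uo oo] ?] ?]; rewrite po uo all_odd_pred ?oo.
by move=> [[? ? ?] [/and4P[po uo + so] ?]]; rewrite all_odd_pred.
Qed.

Lemma Sbar_genfun_set n :
  [set pi | Sbar pi /\ size2 pi = n]%classic = [set pi : seq nat * seq nat |
      [/\ is_partition pi.1, pi.1 != [::] & all (dvdn 1) pi.1] /\
      [&& is_partition pi.2, uniq pi.2, all (fun i => 1 %| i.-1)%N pi.2 &
          all (fun i => smallest_part pi.1 < i)%N pi.2] /\
      (sumn pi.1 + sumn pi.2)%N = n]%classic.
Proof.
apply/funext => -[p o]; apply/propext; rewrite /Sbar /size2 /=.
rewrite (all_dvdn1 id) (all_dvdn1 predn); split.
  by move=> [[? ? -> -> ->] ?].
by move=> [[? ? _] [/and4P[? ? _ ?] ?]].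
Qed.

Theorem theorem3p1 (k n : nat) (hk : (1 <= k)%N) (hn : (1 <= n)%N) :
  [/\ M2spt k n = \sum_(pi \in [set pi | S2 pi /\ size2 pi = n]) omega k pi.1,
      sptbar k n = \sum_(pi \in [set pi | Sbar pi /\ size2 pi = n]) omega k pi.1 &
      spt2bar k n =
        \sum_(pi \in [set pi | S2bar pi /\ size3 pi = n]) omega k pi.1.1].
Proof.
have Hq := ordge_q.
have Hq2 : ordge 1 (q ^+ 2) by apply: ordge_qX.
have Hnq : ordge 1 (- q) by apply: ordgeN.
have H0 : ordge 1 (0 : fps (laurent int)) by move=> i _; apply: fps0E.
split.
- rewrite /M2spt /M2 /N2 fsum_coefB S2_genfun_set.
  rewrite (rank_osum Hq2 H0 Hnq (@gauss_num_M2 _ q)).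
  exact: moment_distinct.
- rewrite /sptbar /Mbar /Nbar fsum_coefB Sbar_genfun_set.
  rewrite (rank_osum Hq H0 Hnq (@gauss_num_bar _ q)).
  by apply: (moment_distinct (d := 1)).
- rewrite /spt2bar /M2bar /N2bar fsum_coefB.
  have He1 : ordge 1 (- q - q ^+ 2) by apply: ordge_sub.
  rewrite (rank_osum Hq2 Hq He1 (@gauss_num_2bar _ q)) (moment_2bar n hk erefl).
  (* Triples nest to the left, while [moment_2bar] pairs pi_1 with all the other components. *)
  pose h (pi : seq nat * seq nat * seq nat) := (pi.1.1, (pi.1.2, pi.2)).
  apply: (reindex_fsbig h); split.
  + move=> [[p a] b] [/= [[? ? ev] [pa oa] [pb ub] +] sz]; rewrite all_cat => /andP[sa sb].
    split; first by rewrite all_dvdn2.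
    rewrite pa pb ub sa sb all_odd_pred // oa (all_dvdn1 predn); split=> //.
    by rewrite addnA.
  + by move=> [[p a] b] [[p' a'] b'] _ _ [-> -> ->].
  + move=> [p [a b]] /= [[? ? ev] [/andP[/and3P[pa + sa] /and4P[pb ub _ sb]] sz]].
    rewrite all_odd_pred // => oa; exists ((p, a), b) => //; split.
      by rewrite /S2bar /= -all_dvdn2 all_cat sa sb.
    by rewrite /size3 /= -addnA.
Qed.
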